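(* Let $R=k[x_0,\ldots,x_n]$ be a polynomial ring over a field $k$ of any characteristic, let $1\le c<s$ be integers, and let $\mathcal F=\{F_1,\ldots,F_s\}$ be a set of $s$ forms in $R$ such that any $c+1$ of them form a regular sequence. Let $I_{c,\mathcal F}=\bigcap_{1\le j_1<\cdots<j_c\le s}(F_{j_1},\ldots,F_{j_c})$. Assume that $\mathcal F$ consists of forms of the same degree $\delta$. Then $R/I_{c,\mathcal F}^{(m)}$ has a Koszul stranded Betti table for any $m\ge 1$. If additionally $I_{c,\mathcal F}$ is a linear star configuration (i.e. $\delta=1$), then $R/I_{c,\mathcal F}^{(m)}$ has a linearly stranded Betti table.
   Context: For a homogeneous ideal $I\subseteq R$ and $m\ge1$, $I^{(m)}=\bigcap_{P\in \mathrm{Ass}(R/I)}(I^mR_P\cap R)$. $\beta_{i,j}(R/I)$ denote the graded Betti numbers of $R/I$ over $R$. Let $1\le n_1<n_2<\cdots<n_r$ be the degrees of the minimal generators of a homogeneous ideal $I$. Then $I$ (or $R/I$) has a Koszul stranded Betti table if there exists a positive integer $\delta$ such that, for every $i\ge 1$, $\beta_{i,j}(R/I)\ne0$ only if $j\in\{n_h+\delta(i-1) \mid h=1,\ldots,r\}$. If $\delta=1$, it has a linearly stranded Betti table. *)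

(* Defs.v *)
From mathcomp Require Import all_boot all_order all_algebra.
From mathcomp Require Import mpoly.
From Stdlib Require Import ClassicalEpsilon.

Set Implicit Arguments.
Unset Strict Implicit.
Unset Printing Implicit Defensive.

Import GRing.Theory.
Local Open Scope ring_scope.

(* Ideals are Prop-valued predicates: none of those below is decidable a
   priori. *)
Section CommutativeAlgebra.
Variable R : comNzRingType.
Implicit Types (I P S : R -> Prop) (f g : R).

Definition ideal_gen S f : Prop :=
  exists (r : nat) (a g : 'I_r -> R),
    (forall i, S (g i)) /\ f = \sum_(i < r) a i * g i.

Definition ideal_pow I (m : nat) : R -> Prop :=
  ideal_gen (fun p => exists g : 'I_m -> R,
    (forall i, I (g i)) /\ p = \prod_(i < m) g i).

Definition prime_ideal P : Prop :=
  [/\ P 0, (forall f g, P f -> P g -> P (f + g)),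
      (forall f g, P g -> P (f * g)), ~ P 1
    & forall f g, P (f * g) -> P f \/ P g].

(* P is in Ass(R/I): P is prime and is the annihilator of the class of some
   f, i.e. P = (I : f). *)
Definition assoc_prime I P : Prop :=
  prime_ideal P /\ exists f, forall g, P g <-> I (g * f).

(* J R_P /\ R, the preimage of J R_P under R -> R_P: f/1 lies in J R_P iff
   u f lies in J for some u outside P. *)
Definition local_contraction (J P : R -> Prop) f : Prop :=
  exists u, ~ P u /\ J (u * f).

Definition symbolic_power I (m : nat) f : Prop :=
  forall P, assoc_prime I P -> local_contraction (ideal_pow I m) P f.

(* Includes the usual requirement R / (fs) <> 0. *)
Definition regular_sequence (fs : seq R) : Prop :=
  (forall i, (i < size fs)%N -> forall g,
     ideal_gen (fun h => h \in take i fs) (g * fs`_i) ->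
     ideal_gen (fun h => h \in take i fs) g)
  /\ ~ ideal_gen (fun h => h \in fs) 1.

Definition star_ideal (s c : nat) (F : 'I_s -> R) f : Prop :=
  forall A : {set 'I_s}, #|A| = c ->
    ideal_gen (fun g => exists2 j, j \in A & g = F j) f.

End CommutativeAlgebra.

Section GradedBetti.
Variables (k : fieldType) (n : nat).
Local Notation R := {mpoly k[n]}.
Implicit Types (I : R -> Prop).

(* Free modules F_i = \bigoplus_a R(- fshift i a), with elements written as
   row vectors, so that fdiff i : F_(i+1) -> F_i and faug : F_0 -> R act by
   right multiplication. *)
Record free_complex := FreeComplex {
  frank : nat -> nat;
  fshift : forall i, 'I_(frank i) -> nat;
  fdiff : forall i, 'M[R]_(frank i.+1, frank i);
  faug : 'cV[R]_(frank 0)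
}.

Definition graded_complex (C : free_complex) : Prop :=
  (forall a, faug C a 0 \is (fshift (f := C) a).-homog) /\
  forall i a b,
    if (fshift (f := C) b <= fshift (f := C) a)%N
    then fdiff C i a b \is (fshift (f := C) a - fshift (f := C) b).-homog
    else fdiff C i a b == 0.

(* ... -> F_1 -> F_0 -> R/I -> 0 is exact, the last map being faug mod I. *)
Definition resolves I (C : free_complex) : Prop :=
  [/\ exists v : 'rV_(frank C 0), I (1 - (v *m faug C) 0 0),
      forall v : 'rV_(frank C 0),
        I ((v *m faug C) 0 0) <-> exists w, v = w *m fdiff C 0
    & forall i (v : 'rV_(frank C i.+1)),
        v *m fdiff C i = 0 <-> exists w, v = w *m fdiff C i.+1].

(* The differentials map into (x_0, ..., x_(n-1)) F_i. *)
Definition minimal_complex (C : free_complex) : Prop :=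
  forall i a b, (fdiff C i a b)@_(0%MM) = 0.

Definition minimal_graded_free_resolution I (C : free_complex) : Prop :=
  [/\ graded_complex C, resolves I C & minimal_complex C].

(* The graded Betti number beta_(i,j)(R/I): the number of summands R(-j) in
   step i of a minimal graded free resolution of R/I. Such a resolution exists,
   and the number does not depend on its choice, when I is homogeneous; the
   value 0 in the other case is a convention. *)
Definition betti I (i j : nat) : nat :=
  match excluded_middle_informative
          (exists C, minimal_graded_free_resolution I C) with
  | left h =>
      let C := proj1_sig (constructive_indefinite_description _ h) in
      #|[set a : 'I_(frank C i) | fshift a == j]|
  | right _ => 0
  end.

Definition minimal_homog_generators I (r : nat) (g : 'I_r -> R) : Prop :=
  [/\ forall i, exists d : nat, g i \is d.-homog,
      forall f, I f <-> ideal_gen (fun h => exists i, h = g i) f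
    & forall i, ~ ideal_gen (fun h => exists2 j, j != i & h = g j) (g i)].

(* The generator is nonzero by minimality, so its degree is unambiguous. *)
Definition min_gen_degree I (d : nat) : Prop :=
  exists (r : nat) (g : 'I_r -> R),
    minimal_homog_generators I g /\ exists i, g i \is d.-homog.

Definition stranded_betti_table (delta : nat) I : Prop :=
  forall i j, (1 <= i)%N -> betti I i j <> 0%N ->
    exists2 d, min_gen_degree I d & j = (d + delta * (i - 1))%N.

Definition koszul_stranded I : Prop :=
  exists2 delta, (0 < delta)%N & stranded_betti_table delta I.

Definition linearly_stranded I : Prop := stranded_betti_table 1 I.

End GradedBetti.

(* Main.v *)
Require Import Defs.
From mathcomp Require Import all_boot all_order all_algebra.
From mathcomp Require Import mpoly zify ring.
From Stdlib Require Import Classical ClassicalEpsilon.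

Set Implicit Arguments.
Unset Strict Implicit.
Unset Printing Implicit Defensive.

Import Order.TTheory GRing.Theory Num.Theory.
Local Open Scope ring_scope.

(** Write F^a for the product of the powers [F i ^+ a i], and let J be the set
    of exponents [a] whose sum over any [c] positions is at least [m]
    ([in_symb]). If the forms were variables y_1, ..., y_s, the [m]-th symbolic
    power would be the monomial ideal J. That ideal is invariant under
    permutations of the variables, and its minimal generators have linear
    quotients for a suitable order: the colon ideal of each generator u by the
    preceding ones is generated by variables. The Koszul complexes of these
    sets of variables then resolve J step by step, and u contributes to the
    i-th step of the resolution in degree deg u + (i - 1) only. Here the forms
    are not variables, but any c + 1 of them form a regular sequence, and this
    is enough to carry the argument from the ring S of polynomials in the y_i
    to R, with each y_i of degree [delta].

    The transfer rests on a filtration of S by monomial ideals from 0 to (1)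
    that passes through J and adds one monomial at a time, with colon ideals
    generated by sets B of variables. Up to J these are the linear quotients,
    where B has fewer than c elements ([inner_filtration]); beyond J they come
    from a Stanley decomposition of the complement of J, where B has exactly c
    elements ([outer_filtration]). The quotients of the filtration are thus
    copies of S/(y_j : j in B), and Tor_1 of such a module against R vanishes
    because the forms of B are a regular sequence. Going down from (1), one
    finds that Tor_1 of S modulo any ideal of the filtration vanishes
    ([filtration_tor1]). It follows that the ideals of R generated by the
    corresponding F^a still have the colon ideals generated by the forms of B
    ([mono_ideal_colon]), and that minimal generators stay minimal
    ([mono_ideal_min_gen]).

    The steps beyond J identify the symbolic power with the ideal of R
    generated by the F^a with a in J. For one inclusion, the other forms are
    invertible at an associated prime of a component
    ([mono_ideal_symbolic_power]). For the other, suppose that f = g + r F^u at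
    the step of u, with r outside the ideal (F_B) of the forms of B. As R is
    Noetherian, some associated prime of (F_B) contains (F_B) : r; it is also
    associated to the star configuration, and clearing denominators there
    contradicts the colon ideal of u ([symbolic_power_descent]).

    The steps up to J bound the Betti numbers. In a minimal resolution each
    basis element gives a nonzero class in the Koszul homology of the variables
    of R with coefficients in the quotient by the ideal, in its own homological
    and internal degrees ([minimal_resolution_koszul_nonzero]). The long exact
    sequences of the filtration bound this Koszul homology from above
    ([ideal_koszul_zero_filtration]), and the only degrees left are those of
    the statement. *)

(** * Ideals and submodules as predicates *)

Section Ideals.
Variable R : comNzRingType.
Implicit Types (I S : R -> Prop).

Definition submod (L : lmodType R) (V : L -> Prop) : Prop :=
  [/\ V 0, forall x y, V x -> V y -> V (x + y) & forall a x, V x -> V (a *: x)].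

Definition is_ideal I : Prop :=
  [/\ I 0, forall x y, I x -> I y -> I (x + y) & forall a x, I x -> I (a * x)].

Lemma ideal_submod I : is_ideal I -> @submod R^o I.
Proof. by case=> *; split. Qed.

Section Submod.
Variables (L : lmodType R) (V : L -> Prop).
Hypothesis sV : submod V.

Lemma submod0 : V 0. Proof. by case: sV. Qed.
Lemma submodD x y : V x -> V y -> V (x + y). Proof. by case: sV => _ h _; apply: h. Qed.
Lemma submodZ a x : V x -> V (a *: x). Proof. by case: sV => _ _; apply. Qed.
Lemma submodN x : V x -> V (- x). Proof. by rewrite -scaleN1r; apply: submodZ. Qed.
Lemma submodB x y : V x -> V y -> V (x - y).
Proof. by move=> hx hy; apply: submodD => //; apply: submodN. Qed.
Lemma submod_sum (T : Type) (r : seq T) (P : pred T) (f : T -> L) :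
  (forall i, P i -> V (f i)) -> V (\sum_(i <- r | P i) f i).
Proof. by move=> h; apply: big_ind => //; [exact: submod0 | exact: submodD]. Qed.
Lemma submodBr x y : V (x - y) -> V y -> V x.
Proof. by move=> h1 h2; rewrite -(subrK y x); apply: submodD. Qed.
Lemma submodBl x y : V (x - y) -> V x -> V y.
Proof.
by move=> h1 h2; rewrite -(subKr x y); apply: submodB.
Qed.
End Submod.

Section IdealTheory.
Variable I : R -> Prop.
Hypothesis idI : is_ideal I.
Lemma ideal_zero : I 0. Proof. by case: idI. Qed.
Lemma ideal_add x y : I x -> I y -> I (x + y). Proof. by case: idI => _ h _; apply: h. Qed.
Lemma ideal_mull a x : I x -> I (a * x). Proof. by case: idI => _ _; apply. Qed.
Lemma ideal_mulr a x : I x -> I (x * a). Proof. by rewrite mulrC; apply: ideal_mull. Qed.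
Lemma ideal_sub x y : I x -> I y -> I (x - y).
Proof. exact: (submodB (ideal_submod idI)). Qed.
Lemma ideal_sum (T : Type) (r : seq T) (P : pred T) (f : T -> R) :
  (forall i, P i -> I (f i)) -> I (\sum_(i <- r | P i) f i).
Proof. exact: (submod_sum (ideal_submod idI)). Qed.
End IdealTheory.

Lemma ideal_gen_incl S g : S g -> ideal_gen S g.
Proof.
by move=> Sg; exists 1%N, (fun=> 1), (fun=> g); split=> //; rewrite big_ord1 mul1r.
Qed.

Lemma ideal_gen_ideal S : is_ideal (ideal_gen S).
Proof.
split.
- by exists 0%N, (fun=> 0), (fun=> 0); split; [case | rewrite big_ord0].
- move=> x y [r1 [a1 [g1 [S1 ->]]]] [r2 [a2 [g2 [S2 ->]]]].
  exists (r1 + r2)%N.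
  exists (fun i => match split i with inl j => a1 j | inr j => a2 j end).
  exists (fun i => match split i with inl j => g1 j | inr j => g2 j end).
  split; first by move=> i; case: (split i).
  rewrite big_split_ord; congr (_ + _); apply: eq_bigr => i _.
    by rewrite (unsplitK (inl i)).
  by rewrite (unsplitK (inr i)).
- move=> b x [r [a [g [Sg ->]]]]; exists r, (fun i => b * a i), g; split=> //.
  by rewrite big_distrr /=; apply: eq_bigr => i _; rewrite mulrA.
Qed.

Lemma ideal_gen_min S I : is_ideal I -> (forall g, S g -> I g) ->
  forall f, ideal_gen S f -> I f.
Proof.
move=> idI h f [r [a [g [Sg ->]]]]; apply: ideal_sum => // i _.
by apply: ideal_mull => //; apply: h.
Qed.

Lemma ideal_gen_mono S S' : (forall g, S g -> S' g) ->
  forall f, ideal_gen S f -> ideal_gen S' f.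
Proof.
move=> h; apply: ideal_gen_min; first exact: ideal_gen_ideal.
by move=> g /h; apply: ideal_gen_incl.
Qed.

End Ideals.

(** * Ideals generated by monomials in the forms *)

Section MonomialIdeals.
Variables (R : comNzRingType) (s : nat) (F : 'I_s -> R).
Implicit Types (a b u v : 'X_{1..s}) (A B : {set 'I_s}) (U : pred 'X_{1..s}).

Definition form_ideal B : R -> Prop := ideal_gen (fun g => exists2 j, j \in B & g = F j).
Definition mono_ideal U : R -> Prop := ideal_gen (fun g => exists a, U a /\ g = mmap1 F a).

Lemma form_ideal_ideal B : is_ideal (form_ideal B). Proof. exact: ideal_gen_ideal. Qed.
Lemma mono_ideal_ideal U : is_ideal (mono_ideal U). Proof. exact: ideal_gen_ideal. Qed.

Lemma form_ideal_incl B j : j \in B -> form_ideal B (F j).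
Proof. by move=> jB; apply: ideal_gen_incl; exists j. Qed.

Lemma mono_ideal_incl U a : U a -> mono_ideal U (mmap1 F a).
Proof. by move=> Ua; apply: ideal_gen_incl; exists a. Qed.

Lemma form_ideal_mono B B' : B \subset B' -> forall f, form_ideal B f -> form_ideal B' f.
Proof.
move=> /subsetP sB f; apply: (@ideal_gen_mono R _ _ _ f) => _ [j /sB jB ->].
by exists j.
Qed.

Lemma mono_ideal_mono U U' : (forall a, U a -> U' a) -> forall f, mono_ideal U f -> mono_ideal U' f.
Proof. move=> h f; apply: (@ideal_gen_mono R _ _ _ f) => _ [a [/h Ua ->]].
by exists a. Qed.

Lemma form_idealP B f : form_ideal B f <-> exists t : 'I_s -> R, f = \sum_(j in B) t j * F j.
Proof.
split; last first.
  case=> t ->; apply: (ideal_sum (form_ideal_ideal B)) => j jB.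
  by apply: (ideal_mull (form_ideal_ideal B)); apply: form_ideal_incl.
apply: (ideal_gen_min (I := fun f => exists t : 'I_s -> R, f = \sum_(j in B) t j * F j))
  => [|_ [j jB ->]].
  split.
  - by exists (fun=> 0); rewrite big1 // => j _; rewrite mul0r.
  - move=> x y [t ->] [t' ->]; exists (fun j => t j + t' j).
    by rewrite -big_split; apply: eq_bigr => j _; rewrite mulrDl.
  - move=> a x [t ->]; exists (fun j => a * t j).
    by rewrite big_distrr /=; apply: eq_bigr => j _; rewrite mulrA.
exists (fun i => (i == j)%:R); rewrite (bigD1 j) //= eqxx mul1r big1 ?addr0 //.
by move=> i /andP[_ /negPf ->]; rewrite mul0r.
Qed.

Lemma mmap1D a b : mmap1 F (a + b) = mmap1 F a * mmap1 F b.
Proof.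
rewrite /mmap1 -big_split; apply: eq_bigr => i _.
by rewrite mnmDE exprD.
Qed.

Lemma mmap1B u a : (u <= a)%MM -> mmap1 F a = mmap1 F (a - u) * mmap1 F u.
Proof. by move=> ua; rewrite -mmap1D submK. Qed.

Lemma form_ideal_mmap1 B a j : j \in B -> (0 < a j)%N -> form_ideal B (mmap1 F a).
Proof.
move=> jB aj; have ua : (U_(j) <= a)%MM by rewrite lep1mP -lt0n.
rewrite (mmap1B ua) mmap1U; apply: (ideal_mull (form_ideal_ideal B)).
exact: form_ideal_incl.
Qed.

Lemma mono_idealP U f : mono_ideal U f <-> exists r (c : 'I_r -> R) (a : 'I_r -> 'X_{1..s}),
  (forall i, U (a i)) /\ f = \sum_(i < r) c i * mmap1 F (a i).
Proof.
split=> [[r [c [g [Ug ->]]]] | [r [c [a [Ua ->]]]]]; last first.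
  apply: (ideal_sum (mono_ideal_ideal U)) => i _; apply: (ideal_mull (mono_ideal_ideal U)).
  exact: mono_ideal_incl.
pose a i := proj1_sig (constructive_indefinite_description _ (Ug i)).
exists r, c, a; split=> [i|]; first exact: (proj1 (proj2_sig
  (constructive_indefinite_description _ (Ug i)))).
by apply: eq_bigr => i _; rewrite {1}(proj2 (proj2_sig (constructive_indefinite_description _
  (Ug i)))).
Qed.

(** * First Tor modules *)

(** The vanishing of Tor_1 of the monomial ring modulo [U] against [R], stated
    without tensor products: a rule on the monomials of [U] that respects
    multiplication, with values in the quotient of [L] by [V], extends to a
    linear map on [mono_ideal U]. *)
Definition tor1_zero U : Prop :=
  forall (L : lmodType R) (V : L -> Prop) (g : 'X_{1..s} -> L), submod V ->
  (forall a b, U a -> V (g (a + b)%MM - mmap1 F b *: g a)) ->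
  forall r (c : 'I_r -> R) (a : 'I_r -> 'X_{1..s}), (forall i, U (a i)) ->
  \sum_(i < r) c i * mmap1 F (a i) = 0 -> V (\sum_(i < r) c i *: g (a i)).

(** A rule defined on the monomial 1 is multiplication of its value there. *)
Lemma tor1_zero_unit U : U 0%MM -> tor1_zero U.
Proof.
move=> U0 L V g sV hg r c a Ua rel.
have -> : \sum_(i < r) c i *: g (a i)
   = \sum_(i < r) c i *: (g (a i) - mmap1 F (a i) *: g 0%MM).
  rewrite [RHS](eq_bigr (fun i => c i *: g (a i) - (c i * mmap1 F (a i)) *: g 0%MM)); last first.
    by move=> i _; rewrite scalerBr scalerA.
  by rewrite sumrB -scaler_suml rel scale0r subr0.
apply: submod_sum => // i _; apply: submodZ => //.
by have := hg 0%MM (a i) U0; rewrite add0m.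
Qed.

Variable c : nat.
Hypothesis nzd : forall B j, (#|B| <= c)%N -> j \notin B ->
  forall g, form_ideal B (g * F j) -> form_ideal B g.

(** The forms of [B] are a regular sequence, so that all the relations among
    them are combinations of the Koszul relations, which [h] respects. *)
Lemma koszul_relations B (L : lmodType R) (V : L -> Prop) (h : 'I_s -> L) (t : 'I_s -> R) :
  (#|B| <= c.+1)%N -> submod V ->
  {in B &, forall i j, V (F i *: h j - F j *: h i)} ->
  \sum_(j in B) t j * F j = 0 -> V (\sum_(j in B) t j *: h j).
Proof.
move=> cB sV hV; move: {2}#|B| (erefl #|B|) cB t => n.
elim: n B hV => [|n IH] B hV cB leB t rel.
  by rewrite (cards0_eq cB) big_set0; apply: submod0.
have /card_gt0P[j jB] : (0 < #|B|)%N by rewrite cB.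
have cB' : #|B :\ j| = n by move: (cardsD1 j B); rewrite jB cB; lia.
have jB' : j \notin B :\ j by rewrite !inE eqxx.
move: rel; rewrite !(big_setD1 j jB) /= => rel.
have /form_idealP[w wE] : form_ideal (B :\ j) (t j).
  apply: (nzd _ jB'); first by rewrite cB'; lia.
  apply/form_idealP; exists (fun i => - t i); apply: (addIr (\sum_(i in B :\ j) t i * F i)).
  by rewrite rel -big_split big1 //= => i _; rewrite -mulrDl addNr mul0r.
(* The coefficient t j is a combination of the other forms, with coefficients
   w; Koszul relations then shift the term of j onto the other terms. *)
have h1 : V (\sum_(i in B :\ j) (t i + w i * F j) *: h i).
  apply: IH => //; [by move=> i k /setD1P[_ iB] /setD1P[_ kB]; apply: hV | lia |].
  rewrite -[RHS]rel wE mulr_suml -big_split; apply: eq_bigr => i _ /=.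
  by rewrite mulrDl addrC mulrAC.
have h2 : V (\sum_(i in B :\ j) w i *: (F i *: h j - F j *: h i)).
  by apply: submod_sum => // i /setD1P[_ iB]; apply: submodZ => //; apply: hV.
have := submodD sV h1 h2; rewrite -big_split /= wE scaler_suml -big_split /=.
congr V; apply: eq_bigr => i _.
by rewrite scalerBr !scalerA scalerDl [in RHS]addrC -addrA; congr (_ + _); rewrite addrC subrK.
Qed.


Section OneStep.
Variables (U U' : pred 'X_{1..s}) (u : 'X_{1..s}) (B : {set 'I_s}).
Hypotheses (upU : forall a b, U a -> U (a + b)%MM)
  (U'E : forall a, U' a = U a || (u <= a)%MM)
  (colon_incl : forall j, j \in B -> U (u + U_(j))%MM)
  (colon_only : forall b, U (u + b)%MM -> exists2 j, j \in B & (0 < b j)%N).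

Lemma head_notin : ~~ U u.
Proof.
by apply/negP => Uu; case: (colon_only (b := 0%MM)) => [|j _]; rewrite ?addm0 ?mnm0E.
Qed.

(** The quotient of [U'] by [U] is a copy of the monomial ring modulo the
    variables of [B], so the long exact sequence of Tor gives the result. A
    rule [g] on [U] need not extend to [U'] with values in [L] itself. It does
    once [L] is enlarged by a new generator, the value at [u], subject to the
    relations that this value has to satisfy: this is the pair [(L * R^o, V')]
    below. A relation among the monomials of [U] is then sent to 0 in the
    enlarged module, hence to 0 in [L], by [koszul_relations]. *)
Lemma tor1_zero_step : (#|B| <= c.+1)%N -> tor1_zero U' -> tor1_zero U.
Proof.
move=> cB T' L V g sV hg r d a Ua rel.
pose V' (x : (L * R^o)%type) := exists t : 'I_s -> R,
  x.2 = \sum_(j in B) t j * F j /\ V (x.1 + \sum_(j in B) t j *: g (u + U_(j))%MM).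
pose g' (b : 'X_{1..s}) : (L * R^o)%type :=
  if U b then (g b, 0) else if (u <= b)%MM then (0, mmap1 F (b - u)%MM) else (0, 0).
have sV' : submod V'.
  split.
  - exists (fun=> 0); rewrite !big1 /= ?addr0; first by split=> //; apply: submod0.
    + by move=> j _; rewrite scale0r.
    + by move=> j _; rewrite mul0r.
  - move=> x y [t [x2 Vx]] [t' [y2 Vy]]; exists (fun j => t j + t' j); split.
      by rewrite /= x2 y2 -big_split; apply: eq_bigr => j _; rewrite mulrDl.
    have := submodD sV Vx Vy; congr V; rewrite addrACA -big_split /=; congr (_ + _).
    by apply: eq_bigr => j _; rewrite scalerDl.
  - move=> e x [t [x2 Vx]]; exists (fun j => e * t j); split.
      by rewrite /= x2 scaler_sumr; apply: eq_bigr => j _; exact: mulrA.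
    have := submodZ sV e Vx; congr V; rewrite scalerDr scaler_sumr; congr (_ + _).
    by apply: eq_bigr => j _; rewrite scalerA.
have hg' b b' : U' b -> V' (g' (b + b')%MM - mmap1 F b' *: g' b).
  rewrite U'E /g'; case: ifPn => [Ub' | nUb'].
    case: ifPn => [Ub _ | nUb /= ub].
      exists (fun=> 0); rewrite !big1 /=; last 2 first.
      + by move=> j _; rewrite scale0r.
      + by move=> j _; rewrite mul0r.
      by rewrite scaler0 subr0 addr0; split=> //; apply: hg.
    rewrite ub; set e := (b - u)%MM.
    have bE : (b + b')%MM = (u + (e + b'))%MM by rewrite addmA [(u + e)%MM]addmC submK.
    have [j jB ej] : exists2 j, j \in B & (0 < (e + b')%MM j)%N.
      by apply: colon_only; rewrite -bE.
    have jle : (U_(j) <= e + b')%MM by rewrite lep1mP -lt0n.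
    pose w := mmap1 F (e + b' - U_(j))%MM.
    exists (fun i => if i == j then - w else 0).
    rewrite !(bigD1 j jB) /= eqxx !big1; last 2 first.
    + by move=> i /andP[_ /negPf ->]; rewrite scale0r.
    + by move=> i /andP[_ /negPf ->]; rewrite mul0r.
    rewrite !addr0 scaler0 sub0r subr0 scaleNr; split.
      rewrite mulNr; congr (- _).
      rewrite [mmap1 F b' *: _]mulrC -mmap1D.
      by rewrite (mmap1B jle) mmap1U.
    rewrite bE (_ : (u + (e + b'))%MM = (u + U_(j) + (e + b' - U_(j)))%MM).
      by apply: hg; apply: colon_incl.
    by rewrite -addmA [(U_(j) + _)%MM]addmC submK.
  case/orP=> [Ub | ub]; first by rewrite (upU b' Ub) in nUb'.
  have /negPf -> : ~~ U b by apply: contra nUb' => Ub; apply: upU.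
  rewrite ub (_ : (u <= b + b')%MM); last first.
    exact: lepm_trans ub (lem_addr _ _).
  have -> : (b + b' - u)%MM = (b - u + b')%MM.
    apply/mnmP => i; rewrite !(mnmBE, mnmDE); move/mnm_lepP/(_ i): ub; lia.
  rewrite [X in V' X](_ : _ = 0); first exact: submod0.
  by rewrite mmap1D [_ * mmap1 F b']mulrC; congr (_, _); rewrite /= ?scaler0 subrr.
have UU' i : U' (a i) by rewrite U'E Ua.
have [t [/esym t0 Vt]] := T' _ V' g' sV' hg' r d a UU' rel.
have fst_sum : (\sum_(i < r) d i *: g' (a i)).1 = \sum_(i < r) d i *: g (a i).
  rewrite (big_morph (fun x : (L * R^o)%type => x.1) (id1 := 0) (op1 := +%R)) //.
  by apply: eq_bigr => i _; rewrite /g' Ua.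
have snd_sum : (\sum_(i < r) d i *: g' (a i)).2 = 0.
  rewrite (big_morph (fun x : (L * R^o)%type => x.2) (id1 := 0) (op1 := +%R)) //.
  by rewrite big1 // => i _; rewrite /g' Ua /= scaler0.
rewrite snd_sum in t0; rewrite fst_sum in Vt.
apply: (submodBr sV (y := - \sum_(j in B) t j *: g (u + U_(j))%MM)).
  by rewrite opprK.
apply: (submodN sV).
apply: (koszul_relations (V := V)) => // i j iB jB.
(* Both terms agree modulo V with the value of g at u + U_i + U_j. *)
have hij := hg _ U_(i)%MM (colon_incl jB); have hji := hg _ U_(j)%MM (colon_incl iB).
have := submodB sV hji hij; rewrite !mmap1U -!addmA (addmC (mnm1 j)); congr V.
by rewrite opprB addrC addrA subrK.
Qed.

(** Suppose that r F^u is a combination of monomials of [U]. This relation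
    among monomials of [U'] persists under the projection of [U'] onto its
    quotient by [U], which kills the monomials of [U] and sends [u] to 1; what
    remains is that [r] is zero modulo [form_ideal B]. *)
Lemma mono_ideal_colon r : tor1_zero U' -> mono_ideal U (r * mmap1 F u) -> form_ideal B r.
Proof.
move=> T' /mono_idealP[d [e [a [aU rE]]]].
pose g (b : 'X_{1..s}) : R^o :=
  if U b then 0 else if (u <= b)%MM then mmap1 F (b - u)%MM else 0.
have sB := ideal_submod (form_ideal_ideal B).
have hg b b' : U' b -> form_ideal B (g (b + b')%MM - mmap1 F b' *: g b).
  rewrite U'E /g; case/orP=> [Ub | ub].
    by rewrite Ub upU // scaler0 subr0; apply: (submod0 sB).
  have ub' : (u <= b + b')%MM by exact: lepm_trans ub (lem_addr _ _).
  have bE : (b + b')%MM = (u + (b + b' - u))%MM by rewrite [RHS]addmC submK.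
  have [Ubb' | Ubb'] := boolP (U (b + b')%MM); have [Ub | Ub] := boolP (U b).
  - by rewrite scaler0 subr0; apply: (submod0 sB).
  - rewrite ub sub0r; apply: (submodN sB).
    have [j jB bj] : exists2 j, j \in B & (0 < (b + b' - u)%MM j)%N.
      by apply: colon_only; rewrite -bE.
    rewrite [_ *: _]mulrC -mmap1D (_ : (b - u + b')%MM = (b + b' - u)%MM).
      exact: form_ideal_mmap1 bj.
    by apply/mnmP => i; rewrite !(mnmBE, mnmDE); move/mnm_lepP/(_ i): ub; lia.
  - by rewrite (upU b' Ub) in Ubb'.
  - rewrite ub ub' [_ *: _]mulrC -mmap1D (_ : (b - u + b')%MM = (b + b' - u)%MM).
      by rewrite subrr; apply: (submod0 sB).
    by apply/mnmP => i; rewrite !(mnmBE, mnmDE); move/mnm_lepP/(_ i): ub; lia.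
pose e' (i : 'I_d.+1) := if unlift ord0 i is Some k then - e k else r.
pose a' (i : 'I_d.+1) := if unlift ord0 i is Some k then a k else u.
have := T' _ _ g sB hg _ e' a' _ _; rewrite !big_ord_recl /e' /a' unlift_none /=.
rewrite /g (negPf head_notin) lepm_refl (_ : (u - u)%MM = 0%MM) ?mmap11; last first.
  by apply/mnmP => i; rewrite mnmBE mnm0E subnn.
under eq_bigr do rewrite liftK; under [X in r *: _ + X]eq_bigr do rewrite liftK aU scaler0.
rewrite sumr_const mul0rn addr0 [_ *: _]mulr1; apply.
  by move=> i; rewrite U'E; case: unliftP => [k _ | _]; rewrite ?aU // lepm_refl orbT.
by rewrite rE -big_split big1 //= => i _; rewrite mulNr subrr.
Qed.

Lemma mono_ideal_colon_incl r : form_ideal B r -> mono_ideal U (r * mmap1 F u).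
Proof.
case/form_idealP=> t ->; rewrite mulr_suml; apply: (ideal_sum (mono_ideal_ideal U)) => j jB.
rewrite -mulrA; apply: (ideal_mull (mono_ideal_ideal U)); rewrite mulrC -(mmap1U F j) -mmap1D.
by apply: mono_ideal_incl; apply: colon_incl.
Qed.

Lemma mono_ideal_step f : mono_ideal U' f <-> exists g r, mono_ideal U g /\ f = g + r * mmap1 F u.
Proof.
split; last first.
  case=> g [r [Ug ->]]; apply: (ideal_add (mono_ideal_ideal U')).
    by apply: mono_ideal_mono Ug => a Ua; rewrite U'E Ua.
  apply: (ideal_mull (mono_ideal_ideal U')); apply: mono_ideal_incl.
  by rewrite U'E lepm_refl orbT.
case/mono_idealP=> d [e [a [aU' ->]]].
apply: (big_ind (fun f => exists g r, mono_ideal U g /\ f = g + r * mmap1 F u)).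
- by exists 0, 0; rewrite mul0r addr0; split=> //; apply: (ideal_zero (mono_ideal_ideal U)).
- move=> x y [g [r [Ug ->]]] [g' [r' [Ug' ->]]]; exists (g + g'), (r + r').
  by rewrite mulrDl addrACA; split=> //; apply: (ideal_add (mono_ideal_ideal U)).
move=> i _; have := aU' i; rewrite U'E; case/orP=> [Ua | ua].
  exists (e i * mmap1 F (a i)), 0; rewrite mul0r addr0; split=> //.
  by apply: (ideal_mull (mono_ideal_ideal U)); apply: mono_ideal_incl.
exists 0, (e i * mmap1 F (a i - u)%MM); rewrite add0r -mulrA -mmap1B //.
by split=> //; apply: (ideal_zero (mono_ideal_ideal U)).
Qed.

End OneStep.

(** Minimal monomial generators remain minimal over [R], by the rule that sends
    [u] to 1 and all other monomials of [U] to 0; it respects multiplication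
    modulo an ideal [V] containing the forms. With [V] the maximal homogeneous
    ideal, the conclusion is absurd. *)
Lemma mono_ideal_min_gen U u (V : R -> Prop) : tor1_zero U -> is_ideal V -> (forall j, V (F j)) ->
  U u -> (forall a, U a -> (a <= u)%MM -> a = u) ->
  mono_ideal (fun a => U a && (a != u)) (mmap1 F u) -> V 1.
Proof.
move=> T idV VF Uu umin /mono_idealP[d [e [a [aU rE]]]].
pose g (b : 'X_{1..s}) : R^o := (b == u)%:R.
have hg b b' : U b -> V (g (b + b')%MM - mmap1 F b' *: g b).
  move=> Ub; rewrite /g; have [b'0 | b'n0] := eqVneq b' 0%MM.
    by rewrite b'0 addm0 mmap11 scale1r subrr; apply: ideal_zero.
  have Vb' : V (mmap1 F b').
    have [j bj] : exists j, b' j != 0%N.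
      apply/existsP; rewrite -negb_forall; apply: contra b'n0 => /forallP b'0.
      by apply/eqP/mnmP => j; rewrite mnm0E; apply/eqP.
    have jb' : (U_(j) <= b')%MM by rewrite lep1mP.
    by rewrite (mmap1B jb') mmap1U; apply: ideal_mull.
  have /negPf -> : (b + b')%MM != u.
    apply/eqP => bu; have bE : b = u by apply: umin => //; rewrite -bu lem_addr.
    move: b'n0; rewrite -(eqm_add2l b) bu addm0 bE eqxx //.
  by rewrite sub0r; apply: (submodN (ideal_submod idV)); apply: (ideal_mulr idV).
pose e' (i : 'I_d.+1) := if unlift ord0 i is Some k then - e k else 1.
pose a' (i : 'I_d.+1) := if unlift ord0 i is Some k then a k else u.
have := T _ _ g (ideal_submod idV) hg _ e' a' _ _.
rewrite !big_ord_recl /e' /a' unlift_none /g eqxx /=.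
under eq_bigr do rewrite liftK.
under [X in 1 *: _ + X]eq_bigr => i _.
  rewrite liftK; have /andP[_ /negPf ->] := aU i; rewrite scaler0; over.
rewrite sumr_const mul0rn addr0 [_ *: _]mulr1; apply.
  by move=> i; case: unliftP => [k _ | _] //; have /andP[] := aU k.
by rewrite mul1r rE -big_split big1 //= => i _; rewrite mulNr subrr.
Qed.

Definition upset (pre : seq 'X_{1..s}) : pred 'X_{1..s} :=
  fun a => has (fun v => (v <= a)%MM) pre.

(** The monomials of [ws] are added to the ideal generated by [pre] one at a
    time. The two conditions at the step of a pair (u, B) say together that
    the colon ideal of [u] by the preceding ideal is generated by the
    variables of [B]. *)
Fixpoint filtration (pre : seq 'X_{1..s}) (ws : seq ('X_{1..s} * {set 'I_s})) : Prop :=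
  if ws is w :: ws' then
    [/\ forall j, j \in w.2 -> upset pre (w.1 + U_(j))%MM,
        forall v, v \in pre -> exists2 j, j \in w.2 & (w.1 j < v j)%N
      & filtration (w.1 :: pre) ws']
  else True.

Lemma upset_add pre a b : upset pre a -> upset pre (a + b)%MM.
Proof.
case/hasP=> v vp va; apply/hasP; exists v => //.
exact: lepm_trans va (lem_addr _ _).
Qed.

Lemma upset_cons u pre a : upset (u :: pre) a = upset pre a || (u <= a)%MM.
Proof. by rewrite /upset /= orbC. Qed.

Lemma upset_colon pre u B b :
  (forall v, v \in pre -> exists2 j, j \in B & (u j < v j)%N) ->
  upset pre (u + b)%MM -> exists2 j, j \in B & (0 < b j)%N.
Proof.
move=> h /hasP[v /h[j jB uj] /mnm_lepP/(_ j)]; rewrite mnmDE => vj.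
by exists j => //; lia.
Qed.

(** Descending induction from the unit ideal, which is where the filtration
    ends. *)
Lemma filtration_tor1 pre (ws : seq ('X_{1..s} * {set 'I_s})) :
  (forall w, w \in ws -> (#|w.2| <= c.+1)%N) ->
  filtration pre ws -> upset (catrev (unzip1 ws) pre) 0%MM -> tor1_zero (upset pre).
Proof.
elim: ws pre => [|[u B] ws IH] pre wc /=; first by move=> _; apply: tor1_zero_unit.
case=> incl only fil up0.
apply: (tor1_zero_step (U' := upset (u :: pre)) (u := u) (B := B)) => //.
- exact: upset_add.
- exact: upset_cons.
- by move=> b; apply: upset_colon.
- by apply: (wc (u, B)); rewrite mem_head.
by apply: IH => // w ws_w; apply: wc; rewrite inE ws_w orbT.
Qed.

Lemma filtration_cat pre ws1 ws2 : filtration pre ws1 ->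
  filtration (catrev (unzip1 ws1) pre) ws2 -> filtration pre (ws1 ++ ws2).
Proof. by elim: ws1 pre => //= w ws1 IH pre [h1 h2 h3] h4; split=> //; apply: IH. Qed.

(** In a sorted list, conditions on the predecessors of an element can be
    stated through the rank; ties are harmless because the last condition
    covers them as well. *)
Lemma sorted_filtration (rk : 'X_{1..s} * {set 'I_s} -> nat) pre ws :
  sorted (relpre rk leq) ws -> uniq ws ->
  (forall w j, w \in ws -> j \in w.2 -> upset pre (w.1 + U_(j))%MM \/
     exists2 x, x \in ws & (rk x < rk w)%N /\ (x.1 <= w.1 + U_(j))%MM) ->
  (forall w v, w \in ws -> v \in pre -> exists2 j, j \in w.2 & (w.1 j < v j)%N) ->
  (forall w x, w \in ws -> x \in ws -> x <> w -> (rk x <= rk w)%N ->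
     exists2 j, j \in w.2 & (w.1 j < x.1 j)%N) ->
  filtration pre ws.
Proof.
elim: ws pre => //= w ws IH pre; rewrite path_sortedE; last first.
  by move=> x y z /=; apply: leq_trans.
case/andP=> /allP wmin srt /andP[wws unq] incl only_pre only_ws; split.
- move=> j jB; case: (incl w j) => //; rewrite ?mem_head // => -[v].
  by rewrite inE => /orP[/eqP -> | /wmin /=]; lia.
- by move=> v; apply: only_pre; rewrite mem_head.
apply: IH => //.
- move=> x j xws jx; have xwws : x \in w :: ws by rewrite inE xws orbT.
  have [hup|[v]] := incl x j xwws jx; first by left; rewrite upset_cons hup.
  rewrite inE; case/orP=> [/eqP -> [_ le]|vws h]; last by right; exists v.
  by left; rewrite upset_cons le orbT.
- move=> x v xws; rewrite inE => /orP[/eqP -> | vpre]; last first.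
    by apply: only_pre; rewrite // inE xws orbT.
  apply: only_ws; rewrite ?inE ?eqxx ?xws ?orbT //; last exact: wmin.
  by move=> wx; rewrite wx xws in wws.
by move=> x v xws vws; apply: only_ws; rewrite inE ?xws ?vws orbT.
Qed.
End MonomialIdeals.

(** * The monomials of the symbolic power *)

Lemma set_extension (T : finType) (X : {set T}) n :
  (#|X| <= n <= #|T|)%N -> exists2 A : {set T}, X \subset A & #|A| = n.
Proof.
move=> /andP[]; move: {2}(n - #|X|)%N (erefl (n - #|X|)%N) => d.
elim: d X => [|d IH] X dE Xn nT; first by exists X => //; lia.
have [x xX] : exists x, x \in ~: X.
  by apply/card_gt0P; rewrite cardsCs setCK; lia.
have cx : #|x |: X| = #|X|.+1 by rewrite cardsU1; move: xX; rewrite inE => ->.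
have [|||A sA cA] := IH (x |: X); [rewrite cx; lia | rewrite cx; lia | exact: nT |].
by exists A => //; apply: subset_trans sA; apply: subsetUr.
Qed.

Section SumFirst.
Local Open Scope nat_scope.

Lemma sum_smallest (T : finType) (f : T -> nat) (A B : {set T}) : #|A| = #|B| ->
  (forall j i, j \in B -> i \notin B -> f j <= f i) ->
  \sum_(j in B) f j <= \sum_(i in A) f i.
Proof.
move=> cAB h; rewrite (big_setID A) /= [leqRHS](big_setID B) /= setIC leq_add2l.
have cD : #|A :\: B| = #|B :\: A|.
  by apply/eqP; rewrite -(eqn_add2l #|A :&: B|) cardsID setIC cardsID cAB.
have [D0|/card_gt0P[x0 x0D]] := posnP #|B :\: A|; first by rewrite (cards0_eq D0) big_set0.
case: (@arg_maxnP _ x0 (mem (B :\: A)) f x0D) => x /setDP[xB _] xmax.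
apply: (@leq_trans (#|B :\: A| * f x)).
  by rewrite -sum_nat_const; apply: leq_sum => y; apply: xmax.
rewrite -cD -sum_nat_const; apply: leq_sum => y; rewrite inE => /andP[yB _].
exact: h.
Qed.

(** Raising [f] by one on [B] preserves the hypothesis of [sum_smallest], and
    costs more on [B] than on any other set of the same size. *)
Lemma sum_smallest_lt (T : finType) (f : T -> nat) (A B : {set T}) : #|A| = #|B| -> A <> B ->
  (forall j i, j \in B -> i \notin B -> f j < f i) ->
  \sum_(j in B) f j < \sum_(i in A) f i.
Proof.
move=> cAB nAB h; pose g i := f i + (i \in B).
have hg : \sum_(j in B) g j <= \sum_(i in A) g i.
  by apply: sum_smallest => // j i jB iB; rewrite /g jB (negPf iB) addn0 addn1; apply: h.
have gE (C : {set T}) : \sum_(i in C) g i = \sum_(i in C) f i + #|C :&: B|.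
  rewrite big_split /= -sum1_card; congr (_ + _).
  rewrite big_mkcond [RHS]big_mkcond; apply: eq_bigr => i _; rewrite inE.
  by case: (i \in C); case: (i \in B).
rewrite !gE setIid in hg; rewrite -(ltn_add2r #|B|); apply: leq_ltn_trans hg _.
rewrite ltn_add2l -cAB ltn_neqAle subset_leq_card ?subsetIl // andbT.
apply/negP => /eqP cI; apply: nAB; apply/eqP.
have /eqP IA : A :&: B == A by rewrite eqEcard subsetIl cI leqnn.
by rewrite eqEcard -{1}IA subsetIr cAB leqnn.
Qed.

End SumFirst.

Section Combinatorics.
Local Open Scope nat_scope.
Variables (s c m : nat).
Hypotheses (c_gt0 : 0 < c) (cs : c < s) (m_gt0 : 0 < m).
Implicit Types (a b u v : 'X_{1..s}) (A B : {set 'I_s}) (i j : 'I_s).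

Definition weight A a : nat := \sum_(i in A) a i.

Definition in_symb a : bool := [forall A : {set 'I_s}, (#|A| == c) ==> (m <= weight A a)].

Lemma in_symbP a : reflect (forall A, #|A| = c -> m <= weight A a) (in_symb a).
Proof.
apply: (iffP forallP) => h A; last by apply/implyP => /eqP; apply: h.
by move=> /eqP cA; have := h A; rewrite cA.
Qed.

Lemma weight_le A a b : (a <= b)%MM -> weight A a <= weight A b.
Proof. by move=> /mnm_lepP ab; apply: leq_sum. Qed.

Lemma weight_lt A a b i : i \in A -> (a <= b)%MM -> a i < b i -> weight A a < weight A b.
Proof.
move=> iA /mnm_lepP ab abi; rewrite /weight !(big_setD1 i iA) /=.
by rewrite -addSn; apply: leq_add => //; apply: leq_sum.
Qed.

Lemma in_symb_le a b : (a <= b)%MM -> in_symb a -> in_symb b.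
Proof. by move=> ab /in_symbP h; apply/in_symbP => A /h /leq_trans; apply; apply: weight_le. Qed.

Lemma weight_setC A a : mdeg a = weight A a + weight (~: A) a.
Proof.
rewrite mdegE (bigID (mem A)) /=; congr (_ + _).
by apply: eq_bigl => i; rewrite inE.
Qed.

Lemma cardC_set A : #|~: A| = s - #|A|.
Proof. by rewrite cardsCs setCK card_ord. Qed.

Lemma weight_const A a M : (forall i, i \in A -> a i = M) -> weight A a = #|A| * M.
Proof. by move=> h; rewrite /weight (eq_bigr (fun=> M)) // sum_nat_const. Qed.

Lemma weight_bound A a M : (forall i, i \in A -> a i <= M) -> weight A a <= #|A| * M.
Proof. by move=> h; rewrite /weight -sum_nat_const; apply: leq_sum. Qed.

Lemma weightU A i : i \in A -> weight A U_(i)%MM = 1.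
Proof.
move=> iA; rewrite /weight (big_setD1 i iA) /= mnm1E eqxx big1 // => j.
by rewrite !inE eq_sym mnm1E => /andP[/negPf ->].
Qed.

Lemma weightD A a b : weight A (a + b)%MM = weight A a + weight A b.
Proof. by rewrite /weight -big_split; apply: eq_bigr => i _; rewrite mnmDE. Qed.

(** * Minimal generators *)

Definition top a : nat := \max_(i < s) a i.
Definition low M a : {set 'I_s} := [set i | a i < M].

(** The exponents of minimal generators: the [c] smallest entries add up to [m]
    and all other entries equal the maximum [M]. Since fewer than [c] entries
    are low, the first condition determines the degree, which is how it is
    stated here, without subtractions. *)
Definition generator M a : bool :=
  [&& [forall i, a i <= M], #|low M a| < c & mdeg a + c * M == s * M + m].

Lemma generatorP M a : reflect [/\ forall i, a i <= M, #|low M a| < c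
  & mdeg a + c * M = s * M + m] (generator M a).
Proof.
apply: (iffP and3P) => [[/forallP h1 h2 /eqP h3] | [h1 h2 h3]]; split=> //.
  exact/forallP.
exact/eqP.
Qed.

Lemma generator_top_attained M a : generator M a -> exists i, a i = M.
Proof.
case/generatorP=> h1 h2 h3; have /card_gt0P[i] : 0 < #|~: low M a| by rewrite cardC_set; lia.
by rewrite !inE -leqNgt => h; exists i; have := h1 i; lia.
Qed.

Lemma generator_top M a : generator M a -> top a = M.
Proof.
move=> ga; have [i ai] := generator_top_attained ga; case/generatorP: ga => h _ _.
apply/eqP; rewrite eqn_leq -{2}ai /top leq_bigmax andbT.
by apply/bigmax_leqP.
Qed.

Lemma generator_weight M a A : generator M a -> #|A| = c -> low M a \subset A -> weight A a = m.
Proof.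
move=> /generatorP[h1 h2 h3] cA sA; have := weight_setC A a.
rewrite (@weight_const (~: A) a M) ?cardC_set ?cA; first by nia.
move=> i; rewrite inE => iA; have : i \notin low M a by apply: contra iA; apply: (subsetP sA).
by rewrite inE -leqNgt; have := h1 i; lia.
Qed.

Lemma generator_in_symb M a : generator M a -> in_symb a.
Proof.
move=> /generatorP[h1 h2 h3]; apply/in_symbP => A cA; have := weight_setC A a.
have := @weight_bound (~: A) a M (fun i _ => h1 i); rewrite cardC_set cA; nia.
Qed.

(** If [b] were smaller at some position, a set of [c] positions containing
    that one and all the low ones would have weight less than [m] in [b]. *)
Lemma generator_minimal M a b : generator M a -> in_symb b -> (b <= a)%MM -> b = a.
Proof.
move=> ga /in_symbP hb /mnm_lepP ba; apply/mnmP => i; apply/eqP.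
rewrite eqn_leq ba leqNgt /=; apply/negP => bai.
have [A sA cA] : exists2 A : {set 'I_s}, i |: low M a \subset A & #|A| = c.
  apply: set_extension; rewrite card_ord (ltnW cs) andbT.
  by case/generatorP: ga => _ h _; rewrite cardsU1; case: (_ \notin _); lia.
have iA : i \in A by apply: (subsetP sA); rewrite setU11.
have := weight_lt iA (introT mnm_lepP ba) bai; have := hb A cA.
rewrite (generator_weight ga cA); first lia.
by apply: subset_trans sA; apply: subsetUr.
Qed.

(** A minimal element has, through each position [j] of its support, a set of
    [c] positions with weight exactly [m]. Applied to a position with maximal
    entry, this forces all entries outside that set to be maximal too. *)
Lemma generator_exists a : in_symb a -> exists u M, generator M u /\ (u <= a)%MM.
Proof.
move: {2}(mdeg a) (leqnn (mdeg a)) => d; elim: d a => [|d IH] a da ha.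
  have a0 : a = 0%MM by apply/eqP; rewrite -mdeg_eq0; lia.
  have [A _ cA] : exists2 A : {set 'I_s}, set0 \subset A & #|A| = c.
    by apply: set_extension; rewrite cards0 card_ord; lia.
  have := in_symbP _ ha A cA; rewrite a0 /weight big1 => [|i _]; first lia.
  by rewrite mnm0E.
have [[j aj hj]|hmin] := classic (exists2 j, 0 < a j & in_symb (a - U_(j))%MM).
  have ja : (U_(j) <= a)%MM by rewrite lep1mP -lt0n.
  have [||u [M [gu ua]]] := IH (a - U_(j))%MM => //.
    by have := congr1 (@mdeg s) (submK ja); rewrite mdegD mdeg1; lia.
  by exists u, M; split=> //; apply: lepm_trans ua _; apply: lem_subr.
(* No variable can be removed from a without leaving the ideal. *)
have tight j : 0 < a j -> exists A, [/\ #|A| = c, j \in A & weight A a = m].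
  move=> aj; have ja : (U_(j) <= a)%MM by rewrite lep1mP -lt0n.
  have /negP : ~ in_symb (a - U_(j))%MM by move=> h; apply: hmin; exists j.
  rewrite negb_forall => /existsP[A]; rewrite negb_imply -ltnNge => /andP[/eqP cA lt].
  have := in_symbP _ ha A cA; have := congr1 (weight A) (submK ja); rewrite weightD.
  have [jA|jA] := boolP (j \in A); first by rewrite weightU // => *; exists A; split=> //; lia.
  rewrite (_ : weight A U_(j)%MM = 0); first by lia.
  rewrite /weight big1 // => i iA; rewrite mnm1E; case: eqVneq => // ji.
  by rewrite ji iA in jA.
have [i0 _ ai0] : exists2 i0, true & forall i, a i <= a i0.
  have i0 : 'I_s by exact: (Ordinal (ltn_trans c_gt0 cs)).
  by case: (@arg_maxnP _ i0 xpredT a) => // i _ h; exists i => // k; apply: h.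
have a0 : 0 < a i0.
  rewrite lt0n; apply/negP => /eqP ai00;
    have [A _ cA] : exists2 A : {set 'I_s}, set0 \subset A & #|A| = c.
    by apply: set_extension; rewrite cards0 card_ord; lia.
  have := in_symbP _ ha A cA; rewrite /weight big1; first lia.
  by move=> i _; have := ai0 i; lia.
have [A [cA i0A wA]] := tight i0 a0.
have out j : j \notin A -> a j = a i0.
  move=> jA; pose A' := j |: (A :\ i0).
  have jA0 : j \notin A :\ i0 by rewrite !inE (negPf jA) andbF.
  have cA' : #|A'| = c by rewrite /A' cardsU1 jA0; move: (cardsD1 i0 A); rewrite i0A;
    rewrite cA /= ?add1n => <-.
  have := in_symbP _ ha A' cA'; rewrite -wA /weight /A' big_setU1 //= (big_setD1 i0 i0A) /=.
  by rewrite leq_add2r => h; apply/eqP; rewrite eqn_leq ai0 h.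
exists a, (a i0); split; last exact: lepm_refl.
apply/generatorP; split=> //.
  have sl : low (a i0) a \subset A :\ i0.
    apply/subsetP => j; rewrite !inE => lt; case: eqVneq => [ji|ji] /=;
      first by rewrite ji in lt; lia.
    by apply/negPn/negP => /out; lia.
  apply: (leq_ltn_trans (subset_leq_card sl)); by rewrite -cA (cardsD1 i0 A) i0A add1n.
rewrite (weight_setC A) wA (@weight_const (~: A) a (a i0)); last by move=> j; rewrite inE;
  apply: out.
by rewrite cardC_set cA; nia.
Qed.


(** * Linear quotients of the ideal of the generators *)

Definition index_sum A : nat := \sum_(i in A) i.+1.

(** The weights [i.+1] matter only in being positive and increasing. *)
Lemma index_sum_lt (X Y : {set 'I_s}) : #|X| <= #|Y| -> 0 < #|Y| ->
  (forall x y, x \in X -> y \in Y -> x < y) -> index_sum X < index_sum Y.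
Proof.
move=> cXY /card_gt0P[y0 y0Y] XY.
case: (@arg_minnP _ y0 (mem Y) (@nat_of_ord s) y0Y) => y yY ymin.
have hX : index_sum X <= #|X| * y.
  by rewrite /index_sum -sum_nat_const; apply: leq_sum => x xX; apply: XY.
have hY : #|Y| * y.+1 <= index_sum Y.
  by rewrite /index_sum -sum_nat_const; apply: leq_sum => z zY; rewrite ltnS; apply: ymin.
have Y0 : 0 < #|Y| by apply/card_gt0P; exists y.
apply: leq_ltn_trans hX _; apply: leq_trans hY; rewrite mulnS.
have : #|X| * y <= #|Y| * y by rewrite leq_mul2r cXY orbT.
by move: (#|X| * y) (#|Y| * y) => p q; lia.
Qed.

Lemma index_sum_setT A : index_sum A <= index_sum setT.
Proof.
rewrite /index_sum [leqRHS](bigID (mem A)) /=.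
apply: leq_trans (leq_addr _ _); apply: eq_leq; apply: eq_bigl => i.
by rewrite inE.
Qed.

(** A lexicographic order: first by increasing [top], which amounts to
    increasing degree, then by decreasing index sum of the low positions. That
    sum grows when a further position becomes low, and when a low position is
    exchanged with a top one of larger index. *)
Definition rank_inner u : nat :=
  top u * (index_sum setT).+1 + (index_sum setT - index_sum (low (top u) u)).

Lemma rank_inner_lt_top u v : top v < top u -> rank_inner v < rank_inner u.
Proof. by rewrite /rank_inner; move: (index_sum setT) => W; nia. Qed.

Lemma rank_inner_lt u v : top v = top u ->
  index_sum (low (top u) u) < index_sum (low (top u) v) -> rank_inner v < rank_inner u.
Proof.
move=> e; rewrite /rank_inner e ltn_add2l.
by have := index_sum_setT (low (top u) v); move: (index_sum _) (index_sum _) (index_sum _); lia.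
Qed.

Lemma rank_inner_le u v : rank_inner v <= rank_inner u -> top u <= top v ->
  top v = top u /\ index_sum (low (top u) u) <= index_sum (low (top u) v).
Proof.
move=> le tuv; have e : top v = top u.
  by apply/eqP; rewrite eqn_leq tuv andbT leqNgt; apply/negP => /rank_inner_lt_top; lia.
split=> //; rewrite leqNgt; apply/negP => lt.
have := @rank_inner_lt v u (esym e); rewrite e => /(_ lt); lia.
Qed.

(** The variables by which [u] can be multiplied to reach an earlier generator.
    An entry two below the top can always be raised; raising an entry one below
    the top amounts to exchanging it with a top entry, and this moves to an
    earlier generator only if that top entry has a larger index. *)
Definition inner_colon u : {set 'I_s} := [set j : 'I_s | (u j < top u) &&
  (((u j).+1 < top u) || [exists i : 'I_s, (j < i) && (u i == top u)])].

Lemma card_colon_in M u : generator M u -> #|inner_colon u| < c.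
Proof.
move=> gu; have := gu => /generatorP[_ h _]; apply: leq_ltn_trans h.
apply: subset_leq_card; apply/subsetP => j.
by rewrite !inE (generator_top gu) => /andP[].
Qed.

Lemma index_sumU1 i A : i \notin A -> index_sum (i |: A) = i.+1 + index_sum A.
Proof. by move=> iA; rewrite /index_sum big_setU1. Qed.

Lemma index_sumD1 i A : i \in A -> index_sum A = i.+1 + index_sum (A :\ i).
Proof. by move=> iA; rewrite /index_sum (big_setD1 i iA). Qed.

(** After [u] is multiplied by the variable of [j], one top entry can be
    lowered to get a generator of the same degree. This would create too many
    low positions if there are already [c - 1] of them and [j] remains low;
    in that case all the top entries can be lowered at once. *)
Lemma inner_colon_incl M u j : generator M u -> j \in inner_colon u ->
  exists v M', [/\ generator M' v, rank_inner v < rank_inner u & (v <= u + U_(j))%MM].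
Proof.
move=> gu; have tu := generator_top gu; rewrite inE tu => /andP[ujM hj].
have := gu => /generatorP[uM cu du].
have exch i : u i = M -> [/\ forall k, (u + U_(j) - U_(i))%MM k = u k + (j == k) - (i == k),
    mdeg (u + U_(j) - U_(i))%MM = mdeg u & i != j].
  move=> uiM; have ij : i != j by apply: contraTneq ujM => <-; rewrite uiM ltnn.
  have le : (U_(i) <= u + U_(j))%MM by rewrite lep1mP mnmDE uiM; lia.
  split=> // [k|]; first by rewrite mnmBE mnmDE !mnm1E.
  by have := congr1 (@mdeg s) (submK le); rewrite !mdegD !mdeg1; lia.
have [uj2|uj2] := ltnP (u j).+1 M; last first.
  have ujM' : (u j).+1 = M by apply/eqP; rewrite eqn_leq ujM uj2.
  move: hj; rewrite ujM' ltnn /= => /existsP[i /andP[ji /eqP uiM]].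
  have [vE dv ij] := exch i uiM.
  have lowE : low M (u + U_(j) - U_(i))%MM = i |: (low M u :\ j).
    apply/setP => k; rewrite !inE vE ![k == _]eq_sym.
    have [jk|jk] := eqVneq j k; have [ik|ik] := eqVneq i k => /=.
    - by move: ij; rewrite jk ik eqxx.
    - by rewrite -jk; lia.
    - by rewrite -ik uiM; lia.
    - by rewrite addn0 subn0.
  have iN : i \notin low M u :\ j by rewrite !inE uiM ltnn andbF.
  have jL : j \in low M u by rewrite inE.
  have gv : generator M (u + U_(j) - U_(i))%MM.
    apply/generatorP; split; last by rewrite dv.
    - move=> k; rewrite vE; have := uM k; have [jk|jk] := eqVneq j k => /=; last lia.
      by rewrite -jk; case: (i == j); lia.
    by move: cu; rewrite lowE cardsU1 iN (cardsD1 j (low M u)) jL.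
  exists (u + U_(j) - U_(i))%MM, M; split=> //; last exact: lem_subr.
  apply: rank_inner_lt; first by rewrite (generator_top gv) tu.
  by rewrite tu lowE (index_sumU1 iN) (index_sumD1 jL) ltn_add2r ltnS.
have [i uiM] := generator_top_attained gu.
have [cu'|cu'] := ltnP #|low M u| c.-1.
  have [vE dv ij] := exch i uiM.
  have lowE : low M (u + U_(j) - U_(i))%MM = i |: low M u.
    apply/setP => k; rewrite !inE vE ![k == _]eq_sym.
    have [jk|jk] := eqVneq j k; have [ik|ik] := eqVneq i k => /=.
    - by move: ij; rewrite jk ik eqxx.
    - by rewrite -jk; lia.
    - by rewrite -ik uiM; lia.
    - by rewrite addn0 subn0.
  have iN : i \notin low M u by rewrite !inE uiM ltnn.
  have gv : generator M (u + U_(j) - U_(i))%MM.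
    apply/generatorP; split; last by rewrite dv.
    - move=> k; rewrite vE; have := uM k; have [jk|jk] := eqVneq j k => /=; last lia.
      by rewrite -jk; case: (i == j); lia.
    by rewrite lowE cardsU1 iN /=; move: cu'; move: #|_| => p; lia.
  exists (u + U_(j) - U_(i))%MM, M; split=> //; last exact: lem_subr.
  apply: rank_inner_lt; first by rewrite (generator_top gv) tu.
  by rewrite tu lowE (index_sumU1 iN) addSn ltnS leq_addl.
pose v := [multinom minn ((u + U_(j))%MM k) M.-1 | k < s].
have vE k : v k = minn ((u + U_(j))%MM k) M.-1 by rewrite mnmE.
have cL : #|low M u| = c.-1 by apply/eqP; rewrite eqn_leq cu' andbT -ltnS (prednK c_gt0).
have wL : weight (low M u) v = (weight (low M u) u).+1.
  rewrite -addn1 -(weightU (i := j) (A := low M u)) ?inE // -weightD.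
  apply: eq_bigr => k; rewrite inE vE !mnmDE !mnm1E; have [<-|_] /= := eqVneq j k; lia.
have wCv : weight (~: low M u) v = #|~: low M u| * M.-1.
  apply: weight_const => k; rewrite !inE -leqNgt vE mnmDE; lia.
have wCu : weight (~: low M u) u = #|~: low M u| * M.
  by apply: weight_const => k; rewrite !inE -leqNgt; have := uM k; lia.
have gv : generator M.-1 v.
  apply/generatorP; split.
  - by move=> k; rewrite vE geq_minr.
  - apply: leq_ltn_trans cu; apply: subset_leq_card; apply/subsetP => k.
    by rewrite !inE vE mnmDE; lia.
  have := weight_setC (low M u) v; have := weight_setC (low M u) u; rewrite wL wCv wCu cardC_set cL.
  by move: du; nia.
exists v, M.-1; split=> //; first by apply: rank_inner_lt_top; rewrite tu (generator_top gv); lia.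
by apply/mnm_lepP => k; rewrite vE geq_minl.
Qed.

(** Otherwise [v] exceeds [u] only at positions one below the top, all of them
    following the top positions of [u]. If the tops differ then [v] divides
    [u]. If they agree then so do the degrees, so that at most as many top
    positions become low in passing from [u] to [v] as entries are raised. The
    former precede the latter, so the index sum of the low positions
    decreases. *)
Lemma inner_colon_only M M' u v : generator M u -> generator M' v -> v <> u ->
  rank_inner v <= rank_inner u ->
  exists2 j, j \in inner_colon u & u j < v j.
Proof.
move=> gu gv vu rk.
have [[j jB uj]|hno] := classic (exists2 j, j \in inner_colon u & u j < v j); first by exists j.
have {hno} le j : u j < v j -> j \notin inner_colon u.
  by move=> uj; apply/negP => jB; apply: hno; exists j.
have tu := generator_top gu; have tv := generator_top gv.
have := gu => /generatorP[uM _ du]; have := gv => /generatorP[vM _ dv].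
exfalso; apply: vu; apply: (generator_minimal gu (generator_in_symb gv)); apply/mnm_lepP.
have [lt k|MM'] := ltnP M' M.
  rewrite leqNgt; apply/negP => ltk; have := le k ltk.
  by rewrite inE tu negb_and negb_or -!leqNgt; have := vM k; lia.
have [] := rank_inner_le rk; rewrite ?tu ?tv // => M'M om.
rewrite {M' tv MM'}M'M in gv om vM dv.
pose E := [set j | u j < v j]; pose X := [set i | (v i < u i) && (u i == M)].
have inE' j : j \in E -> [/\ (u j).+1 = M, v j = M & forall i : 'I_s, j < i -> u i <> M].
  rewrite inE => ltj; have := le j ltj; have vj := vM j.
  have uj : u j < M by lia.
  rewrite inE tu uj /= negb_or -leqNgt negb_exists => /andP[h1 /forallP h2].
  split; [lia | lia |]; move=> i ji uiM; have := h2 i; by rewrite ji uiM eqxx.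
have cXE : #|X| <= #|E|.
  have : mdeg v + #|X| <= mdeg u + #|E|.
    rewrite !mdegE -!sum1_card [\sum_(i in X) 1]big_mkcond [\sum_(i in E) 1]big_mkcond.
    rewrite -!big_split; apply: leq_sum => i _ /=.
    have [iE|iE] := boolP (i \in E).
      by have [h1 h2 _] := inE' i iE; rewrite ifN ?inE; lia.
    by move: iE; rewrite !inE; case: ifP => /=; lia.
  have mE : mdeg v = mdeg u by lia.
  by rewrite mE leq_add2l.
have lowE : index_sum (low M v) + index_sum E = index_sum (low M u) + index_sum X.
  rewrite /index_sum ![\sum_(i in _) _]big_mkcond -!big_split.
  apply: eq_bigr => i _ /=.
  have [iE|iE] := boolP (i \in E).
    have [h1 h2 _] := inE' i iE; rewrite !inE h2 ltnn; have -> : u i < M by lia.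
    have -> /= : (M < u i) = false by lia.
    lia.
  move: iE; rewrite !inE; have := uM i; have := vM i.
  by case: ifP => h1; case: ifP => h2; case: ifP => h3 /=; lia.
move=> k; rewrite leqNgt; apply/negP => ltk.
have E0 : 0 < #|E| by apply/card_gt0P; exists k; rewrite inE.
have := index_sum_lt cXE E0; move: om lowE.
move: (index_sum _) (index_sum _) (index_sum _) (index_sum _) => p q r t om lowE.
suff h : forall x y, x \in X -> y \in E -> x < y by move=> /(_ h); lia.
move=> x y; rewrite inE => /andP[_ /eqP ux] yE; have [h1 _ h3] := inE' y yE.
rewrite ltnNge leq_eqVlt negb_or -leqNgt; apply/andP; split.
  by apply/eqP => /ord_inj yx; move: h1; rewrite yx ux; lia.
by rewrite leqNgt; apply/negP => /h3.
Qed.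

(** * A Stanley decomposition of the complement *)

(** Orders the positions of [u] by exponent, ties being broken by the index.
    Since indices are less than [s], this encodes the lexicographic order. *)
Definition pos_key u j : nat := s * u j + j.
Definition rho u B : nat := \sum_(j in B) pos_key u j.
Definition smallest B u : Prop := forall j i, j \in B -> i \notin B -> pos_key u j < pos_key u i.

(** A monomial outside J is filed according to the positions [B] of its [c]
    smallest entries and the entries there. The monomials with given data are
    the multiples, by variables outside [B], of a least one; the maximum below
    is the smallest entry that keeps a position outside [B] behind those of
    [B]. *)
Definition outer_base u B : bool :=
  [&& #|B| == c, weight B u < m &
      [forall i, (i \notin B) ==> (u i == \max_(j in B) (u j + (i < j)))]].

Lemma outer_baseP u B : reflect [/\ #|B| = c, weight B u < m &
  forall i, i \notin B -> u i = \max_(j in B) (u j + (i < j))] (outer_base u B).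
Proof.
apply: (iffP and3P) => [[/eqP h1 h2 /forallP h3] | [h1 h2 h3]]; split=> //.
- by move=> i iB; have := h3 i; rewrite iB => /eqP.
- exact/eqP.
- by apply/forallP => i; apply/implyP => iB; apply/eqP/h3.
Qed.

Lemma pos_key_lt u i j : (pos_key u j < pos_key u i) = (u j + (i < j) <= u i) && (i != j).
Proof.
rewrite /pos_key; have := ltn_ord i; have := ltn_ord j => hj hi.
have -> : (i != j) = (i != j :> nat) by [].
case: (ltngtP i j) => ij /=; rewrite ?andbT ?andbF ?addn0 ?addn1.
- by apply/idP/idP; nia.
- by apply/idP/idP; nia.
- have -> : i = j by apply: ord_inj.
  by rewrite ltnn.
Qed.

Lemma outer_base_smallest u B : outer_base u B -> smallest B u.
Proof.
case/outer_baseP=> _ _ h j i jB iB; rewrite pos_key_lt (h i iB).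
rewrite (leq_bigmax_cond (F := fun j : 'I_s => u j + (i < j))) //=.
by apply: contra iB => /eqP ->.
Qed.

Lemma smallest_exists u : exists2 B : {set 'I_s}, #|B| = c & smallest B u.
Proof.
have [A _ /eqP cA] : exists2 A : {set 'I_s}, set0 \subset A & #|A| = c.
  by apply: set_extension; rewrite cards0 card_ord; lia.
case: (@arg_minnP _ A (fun A : {set 'I_s} => #|A| == c) (rho u) cA) => B /eqP cB Bmin.
exists B => // j i jB iB; rewrite ltn_neqAle; apply/andP; split.
  apply/negP => /eqP e.
  have : ~~ (pos_key u j < pos_key u i) && ~~ (pos_key u i < pos_key u j) by rewrite e ltnn.
  rewrite !pos_key_lt [j == i]eq_sym.
  have -> : i != j by apply: contra iB => /eqP ->.
  rewrite !andbT; case: (ltngtP i j) => [ij|ij|/ord_inj ij]; [lia.. | by rewrite ij jB in iB].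
have iB' : i \notin B :\ j by rewrite !inE (negPf iB) andbF.
have cB' : #|i |: (B :\ j)| == c.
  by rewrite cardsU1 iB' -cB (cardsD1 j B) jB.
by have := Bmin _ cB'; rewrite /rho big_setU1 //= (big_setD1 j jB) /= leq_add2r.
Qed.

Lemma smallest_le B u j i : smallest B u -> j \in B -> i \notin B -> u j + (i < j) <= u i.
Proof. by move=> fB jB iB; have := fB j i jB iB; rewrite pos_key_lt => /andP[]. Qed.

Lemma smallest_symb B u : #|B| = c -> smallest B u -> in_symb u = (m <= weight B u).
Proof.
move=> cB fB; apply/in_symbP/idP => [h | h A cA]; first exact: h.
apply: leq_trans h _; apply: sum_smallest => [|j i jB iB]; first by rewrite cA.
by apply: leq_trans (smallest_le fB jB iB); apply: leq_addr.
Qed.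

Lemma outer_base_exists a : in_symb a \/
  exists v B, [/\ outer_base v B, smallest B a, (v <= a)%MM & forall j, j \in B -> v j = a j].
Proof.
have [B cB fB] := smallest_exists a; rewrite (smallest_symb cB fB).
have [|lt] := leqP m (weight B a); first by left.
right; pose v := [multinom if i \in B then a i else \max_(j in B) (a j + (i < j)) | i < s].
have vB j : j \in B -> v j = a j by rewrite mnmE => ->.
exists v, B; split=> //.
  apply/outer_baseP; split=> //; first by rewrite (_ : weight B v = weight B a) //;
    apply: eq_bigr => j /vB.
  move=> i iB; rewrite mnmE (negPf iB); apply: eq_bigr => j jB.
  by rewrite vB.
apply/mnm_lepP => i; rewrite mnmE; case: ifPn => // iB.
by apply/bigmax_leqP => j jB; apply: smallest_le jB iB.
Qed.

Lemma rho_bound u B : outer_base u B -> rho u B <= c * (s * m + s).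
Proof.
case/outer_baseP=> cB wB _; rewrite -cB -sum_nat_const; apply: leq_sum => j jB.
rewrite /pos_key; apply: leq_add; last exact: ltnW (ltn_ord j).
rewrite leq_mul2l; apply/orP; right; apply: leq_trans (ltnW wB).
by rewrite /weight (big_setD1 j jB) leq_addr.
Qed.

Definition rank_outer u B : nat := c * (s * m + s) - rho u B.

(** The [c] smallest keys of [u] times the variable of [j] have a larger sum
    than those of [u]: either the positions [B] stay and the key of [j] grows,
    or they change, and no set other than [B] has so small a sum for [u]. *)
Lemma outer_base_incl u B j : outer_base u B -> j \in B -> in_symb (u + U_(j))%MM \/
  exists v B', [/\ outer_base v B', rank_outer v B' < rank_outer u B & (v <= u + U_(j))%MM].
Proof.
move=> ou jB; have [|[v [B' [ov fB' vle vE]]]] := outer_base_exists (u + U_(j))%MM; first by left.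
right; exists v, B'; split=> //.
suff lt : rho u B < rho v B' by rewrite /rank_outer; have := rho_bound ov; lia.
have rE : rho v B' = rho u B' + (if j \in B' then s else 0).
  rewrite /rho; case: ifPn => jB'.
    rewrite !(big_setD1 j jB') /= (eq_bigr (pos_key u)) => [|i]; last first.
      rewrite !inE => /andP[/negPf ij iB']; rewrite /pos_key vE // mnmDE mnm1E eq_sym ij.
      by rewrite addn0.
    move: (\sum_(i in _) _) => S; rewrite /pos_key vE // mnmDE mnm1E eqxx mulnDr.
    by rewrite muln1; lia.
  rewrite addn0; apply: eq_bigr => i iB'; rewrite /pos_key vE // mnmDE mnm1E.
  by case: eqVneq => [ji|_]; rewrite ?addn0 //; rewrite ji iB' in jB'.
have cB := outer_baseP _ _ ou; case: cB => cB _ _; have [cB' _ _] := outer_baseP _ _ ov.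
rewrite rE; have [BB'|/eqP BB'] := eqVneq B' B.
  by rewrite BB' jB -addn1 leq_add2l; lia.
apply: leq_trans (leq_addr _ _); apply: sum_smallest_lt => //; first by rewrite cB.
exact: outer_base_smallest.
Qed.

Lemma outer_base_only_symb u B v : outer_base u B -> in_symb v -> exists2 j, j \in B & u j < v j.
Proof.
case/outer_baseP=> cB wB _ /in_symbP hv.
have [|hno] := classic (exists2 j, j \in B & u j < v j) => //.
have := hv B cB; rewrite leqNgt (leq_ltn_trans _ wB) //; apply: leq_sum => j jB.
by rewrite leqNgt; apply/negP => lt; apply: hno; exists j.
Qed.

(** If [v] is at most [u] on [B], then the sum of the [c] smallest keys of [v]
    is at most that of [u]; by the comparison of ranks they agree, so [B'] is [B]
    and the entries there coincide. *)
Lemma outer_base_only u B v B' : outer_base u B -> outer_base v B' -> (v, B') <> (u, B) ->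
  rank_outer v B' <= rank_outer u B -> exists2 j, j \in B & u j < v j.
Proof.
move=> ou ov ne rk; have rk' : rho u B <= rho v B'.
  by move: rk; rewrite /rank_outer; have := rho_bound ou; have := rho_bound ov; lia.
have [|hno] := classic (exists2 j, j \in B & u j < v j) => //.
have vu j : j \in B -> v j <= u j.
  by move=> jB; rewrite leqNgt; apply/negP => lt; apply: hno; exists j.
have key j : j \in B -> pos_key v j <= pos_key u j.
  by move=> jB; rewrite /pos_key leq_add2r leq_mul2l vu ?orbT.
have rB : rho v B <= rho u B by apply: leq_sum => j /key.
have [cB _ hu] := outer_baseP _ _ ou; have [cB' _ hv] := outer_baseP _ _ ov.
have BB' : B = B'.
  apply/eqP; apply/negP => /negP/eqP BB'; have : rho v B' < rho v B; last lia.
  by apply: sum_smallest_lt; [rewrite cB | | apply: outer_base_smallest].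
exfalso; apply: ne; rewrite -BB'; congr (_, _).
have vuB j : j \in B -> v j = u j.
  move=> jB; apply/eqP; rewrite eqn_leq vu //= leqNgt; apply/negP => lt.
  have : rho v B < rho u B; last by rewrite -BB' in rk'; lia.
  rewrite /rho !(big_setD1 j jB) /= -addSn; apply: leq_add.
    by rewrite /pos_key ltn_add2r ltn_mul2l lt andbT; lia.
  by apply: leq_sum => i; rewrite inE => /andP[_ /key].
apply/mnmP => i; have [/vuB //|iB] := boolP (i \in B).
rewrite hu // hv -?BB' //; apply: eq_bigr => j jB.
by rewrite vuB.
Qed.

(** * The full filtration *)

Lemma mdeg_bound u M : (forall i, u i <= M) -> mdeg u <= s * M.
Proof.
move=> h; have -> : s * M = \sum_(i < s) M by rewrite sum_nat_const card_ord.
by rewrite mdegE; apply: leq_sum.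
Qed.

Lemma generator_mdeg M u : generator M u -> mdeg u < (s * m).+1.
Proof.
move=> gu; have [h1 h2 h3] := generatorP _ _ gu.
have Mm : M <= m by have := generator_weight gu; have := weight_setC (low M u) u;
  rewrite (@weight_const (~: low M u) u M) ?cardC_set; [nia | by move=> i; rewrite !inE -leqNgt;
    have := h1 i; lia].
by rewrite ltnS; apply: mdeg_bound => i; apply: leq_trans Mm.
Qed.

Lemma outer_base_mdeg u B : outer_base u B -> mdeg u < (s * m).+1.
Proof.
case/outer_baseP=> cB wB h.
have uB j : j \in B -> u j < m.
  by move=> jB; apply: leq_trans wB; rewrite /weight (big_setD1 j jB) ltnS leq_addr.
rewrite ltnS; apply: mdeg_bound => i.
have [iB|iB] := boolP (i \in B); first exact: ltnW (uB i iB).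
rewrite h //; apply/bigmax_leqP => j jB; have := uB j jB; case: (i < j); lia.
Qed.

(** All entries of the monomials involved are at most [m], so that they can be
    listed as monomials of degree at most [s * m]. *)
Definition inner : seq ('X_{1..s} * {set 'I_s}) :=
  sort (relpre (fun w => rank_inner w.1) leq)
    [seq (bmnm x, inner_colon x)
       | x : 'X_{1..s < (s * m).+1} in [pred x : 'X_{1..s < (s * m).+1} | generator (top x) x]].

Definition outer : seq ('X_{1..s} * {set 'I_s}) :=
  sort (relpre (fun w => rank_outer w.1 w.2) leq)
    [seq (bmnm x.1, x.2) | x : 'X_{1..s < (s * m).+1} * {set 'I_s}
       in [pred x : 'X_{1..s < (s * m).+1} * {set 'I_s} | outer_base x.1 x.2]].

Lemma innerP w : reflect (exists2 M, generator M w.1 & w.2 = inner_colon w.1) (w \in inner).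
Proof.
rewrite mem_sort; apply: (iffP imageP) => [[x gx ->] | [M gM wE]]; first by exists (top x).
exists (BMultinom (generator_mdeg gM)); first by rewrite inE /= (generator_top gM).
by rewrite /= -wE; case: w {gM wE}.
Qed.

Lemma outerP w : reflect (outer_base w.1 w.2) (w \in outer).
Proof.
rewrite mem_sort; apply: (iffP imageP) => [[x ox ->] // | ow].
by exists (BMultinom (outer_base_mdeg ow), w.2) => //=; case: w {ow}.
Qed.

Lemma inner_uniq : uniq (unzip1 inner).
Proof.
rewrite (perm_uniq (perm_map fst (permEl (perm_sort _ _)))) -map_comp.
by rewrite map_inj_uniq ?enum_uniq //; apply: val_inj.
Qed.

Lemma upset_inner a : upset (rev (unzip1 inner)) a = in_symb a.
Proof.
apply/hasP/idP => [[v] | /generator_exists[u [M [gu ua]]]].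
  rewrite mem_rev => /mapP[w /innerP[M gM _] ->] wa.
  by apply: in_symb_le wa (generator_in_symb gM).
exists u => //; rewrite mem_rev; apply/mapP; exists (u, inner_colon u) => //.
by apply/innerP; exists M.
Qed.

Lemma upset_outer a : upset (catrev (unzip1 outer) (rev (unzip1 inner))) a.
Proof.
rewrite /upset catrevE has_cat; have [sa|[v [B [ov _ va _]]]] := outer_base_exists a.
  by rewrite [X in _ || X]upset_inner sa orbT.
apply/orP; left; apply/hasP; exists v => //; rewrite mem_rev.
by apply/mapP; exists (v, B) => //; apply/outerP.
Qed.

Lemma inner_filtration : filtration [::] inner.
Proof.
apply: (sorted_filtration (rk := fun w => rank_inner w.1)).
- by apply: sort_sorted => x y; apply: leq_total.
- by rewrite sort_uniq map_inj_uniq ?enum_uniq // => x y [/val_inj].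
- move=> w j /innerP[M gM ->] jB; right.
  have [v [M' [gv rk le]]] := inner_colon_incl gM jB.
  by exists (v, inner_colon v); [apply/innerP; exists M' |].
- by [].
move=> w x /innerP[M gM wE] /innerP[M' gM' xE] xw rk.
rewrite wE; apply: (inner_colon_only gM gM' _ rk) => e; apply: xw.
by rewrite (surjective_pairing x) xE e -wE -surjective_pairing.
Qed.

Lemma outer_filtration : filtration (rev (unzip1 inner)) outer.
Proof.
apply: (sorted_filtration (rk := fun w => rank_outer w.1 w.2)).
- by apply: sort_sorted => x y; apply: leq_total.
- by rewrite sort_uniq map_inj_uniq ?enum_uniq // => -[x B] [y B'] [/val_inj -> ->].
- move=> w j /outerP ow jB; have [h|[v [B' [ov rk le]]]] := outer_base_incl ow jB.
    by left; rewrite upset_inner.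
  by right; exists (v, B') => //; apply/outerP.
- move=> w v /outerP ow vin; apply: (outer_base_only_symb ow); rewrite -upset_inner.
  by apply/hasP; exists v => //; apply: lepm_refl.
move=> w x /outerP ow /outerP ox xw rk; apply: outer_base_only ow ox _ rk.
by rewrite -!surjective_pairing.
Qed.
End Combinatorics.

(** * Graded ideals and regular sequences of forms *)

Section Graded.
Variables (k : fieldType) (N : nat).
Local Notation R := {mpoly k[N]}.
Implicit Types (I V : R -> Prop) (f g a : R).

Definition graded_ideal V : Prop := forall d f, V f -> V (pihomog mdeg d f).

Definition nonzerodivisor V a : Prop := forall g, V (g * a) -> V g.

Lemma pihomog_homog d e g : g \is e.-homog -> pihomog mdeg d g = if d == e then g else 0.
Proof.
move=> hg; case: eqVneq => [->|ne]; first exact: pihomog_dE.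
by apply: pihomog_ne0 hg; rewrite eq_sym.
Qed.

Lemma pihomog_sum_eq g : exists K, g = \sum_(d < K) pihomog mdeg d g.
Proof. by exists (mmeasure mdeg g); apply: pihomog_partitionE. Qed.

Lemma pihomogMl d e a g : g \is e.-homog ->
  pihomog mdeg d (a * g) = (if (e <= d)%N then pihomog mdeg (d - e) a else 0) * g.
Proof.
move=> hg; have [K aE] := pihomog_sum_eq a.
rewrite {1}aE mulr_suml linear_sum /=.
under eq_bigr => i _ do
  rewrite (pihomog_homog _ (dhomogM (pihomogP _ _ _) hg)).
rewrite -big_mkcond /=; case: leqP => ed.
  rewrite [in RHS]aE linear_sum mulr_suml /= big_mkcond; apply: eq_bigr => i _.
  rewrite (pihomog_homog _ (pihomogP _ _ _)).
  rewrite (_ : (d == i + e)%N = (d - e == i)%N); first by case: ifP; rewrite ?mul0r.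
  by apply/eqP/eqP; lia.
by rewrite mul0r big1 // => i /eqP; lia.
Qed.

Lemma ideal_gen_graded (S : R -> Prop) :
  (forall g, S g -> exists e, g \is e.-homog) -> graded_ideal (ideal_gen S).
Proof.
move=> hS d f [r [a [g [Sg ->]]]]; rewrite linear_sum /=.
apply: (ideal_sum (ideal_gen_ideal S)) => i _; have [e he] := hS _ (Sg i).
rewrite (pihomogMl _ _ he); apply: (ideal_mull (ideal_gen_ideal S)).
exact: ideal_gen_incl.
Qed.

Section Forms.
Variables (s delta : nat) (F : 'I_s -> R).
Hypotheses (delta_gt0 : (0 < delta)%N) (hF : forall i, F i \is delta.-homog).
Implicit Types (P : {set 'I_s}) (l : seq 'I_s).

Lemma mmap1_homog (a : 'X_{1..s}) : mmap1 F a \is (delta * mdeg a).-homog.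
Proof.
rewrite /mmap1 mdegE big_distrr /=.
apply: (big_ind2 (fun (p : R) d => p \is d.-homog)) => [||i _].
- exact: dhomog1.
- by move=> p d q e; apply: dhomogM.
by apply: dhomogMn.
Qed.

Lemma form_ideal_graded P : graded_ideal (form_ideal F P).
Proof. by apply: ideal_gen_graded => _ [j _ ->]; exists delta. Qed.

Lemma mono_ideal_graded U : graded_ideal (mono_ideal F U).
Proof. by apply: ideal_gen_graded => _ [a [_ ->]]; exists (delta * mdeg a)%N;
  apply: mmap1_homog. Qed.

Lemma form_idealU1 P j f : form_ideal F (j |: P) f <->
  exists v r, form_ideal F P v /\ f = v + r * F j.
Proof.
split; last first.
  case=> v [r [Pv ->]]; apply: (ideal_add (form_ideal_ideal F _)).
    by apply: form_ideal_mono Pv; apply: subsetUr.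
  by apply: (ideal_mull (form_ideal_ideal F _)); apply: form_ideal_incl; rewrite setU11.
move: f; apply: (ideal_gen_min (I := fun f => exists v r, form_ideal F P v /\ f = v + r * F j)).
  split.
  - by exists 0, 0; rewrite mul0r addr0; split=> //; apply: (ideal_zero (form_ideal_ideal F _)).
  - move=> x y [v [r [Pv ->]]] [v' [r' [Pv' ->]]]; exists (v + v'), (r + r').
    by rewrite mulrDl addrACA; split=> //; apply: (ideal_add (form_ideal_ideal F _)).
  - move=> b x [v [r [Pv ->]]]; exists (b * v), (b * r).
    by rewrite mulrDr mulrA; split=> //; apply: (ideal_mull (form_ideal_ideal F _)).
move=> g [i]; rewrite !inE => /orP[/eqP -> | iP] ->.
  by exists 0, 1; rewrite mul1r add0r; split=> //; apply: (ideal_zero (form_ideal_ideal F _)).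
by exists (F i), 0; rewrite mul0r addr0; split=> //; apply: form_ideal_incl.
Qed.

(** Homogeneous regular sequences can be permuted. If [F b] times [g] lies in
    the ideal of [P], then [g] is a multiple of [F a] modulo that ideal, and the
    quotient has the same property in a smaller degree; this descent shows
    that [F b] is a nonzerodivisor already modulo the forms of [P]. *)
Lemma nonzerodivisor_swap P (a b : 'I_s) : nonzerodivisor (form_ideal F P) (F a) ->
  nonzerodivisor (form_ideal F (a |: P)) (F b) ->
  nonzerodivisor (form_ideal F P) (F b) /\ nonzerodivisor (form_ideal F (b |: P)) (F a).
Proof.
move=> na nb; have idP := form_ideal_ideal F P.
have hom e g : g \is e.-homog -> form_ideal F P (g * F b) -> form_ideal F P g.
  elim/ltn_ind: e g => e IH g hg Pgb.
  have /form_idealU1[v [r [Pv gE]]] : form_ideal F (a |: P) g.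
    by apply: nb; apply: form_ideal_mono Pgb; apply: subsetUr.
  have := congr1 (pihomog mdeg e) gE; rewrite (pihomog_dE hg) linearD /=.
  rewrite (pihomogMl _ _ (hF a)) => {}gE.
  have Pv' := form_ideal_graded e Pv; move: gE; case: leqP => de gE; last first.
    by rewrite gE mul0r addr0.
  set r' := pihomog mdeg (e - delta) r in gE.
  have Pr' : form_ideal F P r'.
    apply: (IH (e - delta)%N); [lia | exact: pihomogP |].
    apply: na; rewrite mulrAC (_ : _ * _ = g * F b - pihomog mdeg e v * F b).
      by apply: (ideal_sub idP) => //; apply: (ideal_mulr idP).
    by rewrite -mulrBl gE addrC addKr.
  by rewrite gE; apply: (ideal_add idP) => //; apply: (ideal_mulr idP).
have nb' : nonzerodivisor (form_ideal F P) (F b).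
  move=> g Pgb; have [K ->] := pihomog_sum_eq g; apply: (ideal_sum idP) => d _.
  apply: (hom d); first exact: pihomogP.
  have := form_ideal_graded (d + delta)%N Pgb; rewrite (pihomogMl _ _ (hF b)) leq_addl.
  by rewrite addnK.
split=> // g /form_idealU1[v [h [Pv gaE]]].
have /form_idealU1[v' [h' [Pv' hE]]] : form_ideal F (a |: P) h.
  apply: nb; apply/form_idealU1; exists (- v), g; split; last by rewrite gaE addKr.
  by rewrite -mulN1r; apply: (ideal_mull idP).
apply/form_idealU1; exists (g - h' * F b), h'; rewrite subrK; split=> //.
apply: na; rewrite mulrBl gaE hE (_ : _ - _ = v + v' * F b); last by ring.
by apply: (ideal_add idP) => //; apply: (ideal_mulr idP).
Qed.

Fixpoint regular_on P l : Prop :=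
  if l is j :: l' then nonzerodivisor (form_ideal F P) (F j) /\ regular_on (j |: P) l' else True.

Lemma regular_on_front P l1 x l2 :
  regular_on P (l1 ++ x :: l2) -> regular_on P (x :: l1 ++ l2).
Proof.
elim: l1 P => //= y l1 IH P [ny /IH[nx reg]].
by have [nx' ny'] := nonzerodivisor_swap ny nx; split=> //; split=> //; rewrite setUCA.
Qed.

Lemma regular_on_perm P l l' : perm_eq l l' -> regular_on P l -> regular_on P l'.
Proof.
elim: l' P l => [|x l' IH] P l //.
move=> pl; have xl : x \in l by rewrite (perm_mem pl) mem_head.
move: pl; case/splitPr: xl => l1 l2 pl /regular_on_front /= [nx reg]; split=> //.
apply: IH reg; rewrite -(perm_cons x); apply: perm_trans pl.
by rewrite -[x :: l1 ++ l2]/([:: x] ++ l1 ++ l2) perm_catCA perm_refl.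
Qed.

Lemma regular_on_cat P l1 x l2 : regular_on P (l1 ++ x :: l2) ->
  nonzerodivisor (form_ideal F (P :|: [set y in l1])) (F x).
Proof.
elim: l1 P => [|y l1 IH] P /= [h reg].
  by move: h; rewrite (_ : [set y in [::]] = set0) ?setU0 //; apply/setP => z; rewrite !inE.
have := IH _ reg; congr (nonzerodivisor (form_ideal F _) _).
by apply/setP => z; rewrite !inE orbA [(z == y) || _]orbC.
Qed.

Lemma regular_sequence_on l : regular_sequence [seq F i | i <- l] -> regular_on set0 l.
Proof.
case=> reg _; have {}reg : forall l1 x l2, l = l1 ++ x :: l2 ->
    nonzerodivisor (form_ideal F (set0 :|: [set y in l1])) (F x).
  move=> l1 x l2 lE g gx; have := reg (size l1); rewrite lE map_cat /= -(size_map F l1).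
  rewrite take_size_cat // nth_cat ltnn subnn /= size_cat /= size_map -addSnnS leq_addr.
  move=> /(_ isT g) h.
  have idE f : ideal_gen (fun p => p \in [seq F i | i <- l1]) f <->
    form_ideal F (set0 :|: [set y in l1]) f.
    split; apply: ideal_gen_mono => p.
      by case/mapP=> j jl ->; exists j => //; rewrite !inE.
    by case=> j; rewrite !inE /= => jl ->; apply: map_f.
  by apply/idE; apply: h; apply/idE.
move: reg; move: set0 => P; elim: l P => [|x l IH] P //= reg; split.
  have := reg [::] x l erefl.
  by rewrite (_ : [set y in [::]] = set0) ?setU0 //; apply/setP => z; rewrite !inE.
apply: IH => l1 y l2 lE; have := reg (x :: l1) y l2; rewrite lE => /(_ erefl).
congr (nonzerodivisor (form_ideal F _) _).
by apply/setP => z; rewrite !inE orbA [(z == x) || _]orbC.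
Qed.

(** Any [P] and [j] can be completed to [c + 1] forms, and the resulting regular
    sequence can be reordered so that it starts with [P] and then [j]. *)
Lemma nonzerodivisor_forms c : (c < s)%N ->
  (forall A : {set 'I_s}, #|A| = c.+1 -> regular_sequence [seq F i | i <- enum A]) ->
  forall P j, (#|P| <= c)%N -> j \notin P -> nonzerodivisor (form_ideal F P) (F j).
Proof.
move=> cs reg P j cP jP.
have [A sA cA] : exists2 A : {set 'I_s}, j |: P \subset A & #|A| = c.+1.
  by apply: set_extension; rewrite card_ord cardsU1 jP; lia.
have jA : j \in A by apply: (subsetP sA); rewrite setU11.
have PA : P \subset A by apply: subset_trans sA; apply: subsetUr.
have pe : perm_eq (enum A) (enum P ++ j :: enum (A :\: (j |: P))).
  apply: uniq_perm; first exact: enum_uniq.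
    rewrite cat_uniq /= !enum_uniq !mem_enum !inE eqxx /= andbT (negPf jP) /=.
    by apply/hasPn => x; rewrite !mem_enum !inE negb_or => /andP[/andP[_]].
  move=> x; rewrite mem_cat inE !mem_enum !inE negb_or.
  have [xP|xP] /= := boolP (x \in P); first by rewrite (subsetP PA).
  by case: eqVneq => [->|].
have := regular_on_cat (regular_on_perm pe (regular_sequence_on (reg A cA))).
by rewrite set0U (_ : [set y in enum P] = P) //; apply/setP => x; rewrite inE mem_enum.
Qed.
End Forms.
End Graded.

(** * The ascending chain condition and associated primes *)

Section Dickson.
Local Open Scope nat_scope.

Definition strictly_increasing (phi : nat -> nat) := forall i j, i < j -> phi i < phi j.

Lemma strictly_increasingS phi : (forall i, phi i < phi i.+1) -> strictly_increasing phi.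
Proof. exact: (homo_ltn ltn_trans). Qed.

(** Each term of the subsequence is chosen as a minimum of a tail. *)
Lemma monotone_subsequence (f : nat -> nat) : exists2 phi, strictly_increasing phi &
  forall i j, i <= j -> f (phi i) <= f (phi j).
Proof.
have min_tail b : exists i, b <= i /\ forall j, b <= j -> f i <= f j.
  have h v : forall i, b <= i -> f i = v -> exists i, b <= i /\ forall j, b <= j -> f i <= f j.
    elim/ltn_ind: v => v IH i bi fi.
    have [[j bj lt]|hno] := classic (exists2 j, b <= j & f j < f i).
      by apply: (IH (f j)) bj _; rewrite -?fi.
    by exists i; split=> // j bj; rewrite leqNgt; apply/negP => lt; apply: hno; exists j.
  exact: (h (f b) b).
pose nxt b := proj1_sig (constructive_indefinite_description _ (min_tail b)).
have nxtP b : b <= nxt b /\ forall j, b <= j -> f (nxt b) <= f j.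
  exact: (proj2_sig (constructive_indefinite_description _ (min_tail b))).
pose fix phi n := if n is n'.+1 then nxt (phi n').+1 else nxt 0.
have phi_lt : strictly_increasing phi.
  by apply: strictly_increasingS => i; have [] := nxtP (phi i).+1.
exists phi => // i j; rewrite leq_eqVlt => /orP[/eqP -> // | ij].
have : phi i <= phi j by apply/ltnW/phi_lt.
case: i {ij} => [|i] /= ij; first by case: (nxtP 0) => _; apply.
case: (nxtP (phi i).+1) => h1; apply; apply: leq_trans ij => //.
Qed.

(** Subsequences are extracted for one variable after the other, until all
    exponents are nondecreasing. *)
Lemma dickson n (f : nat -> 'X_{1..n}) : exists i j, i < j /\ (f i <= f j)%MM.
Proof.
have h q : q <= n -> exists2 phi, strictly_increasing phi &
    forall p : 'I_n, p < q -> forall i j, i <= j -> f (phi i) p <= f (phi j) p.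
  elim: q => [|q IH] qn; first by exists id.
  have [phi phi_lt phi_le] := IH (ltnW qn).
  have [psi psi_lt psi_le] := monotone_subsequence (fun i => f (phi i) (Ordinal qn)).
  exists (phi \o psi) => [i j ij | p]; first exact/phi_lt/psi_lt.
  rewrite ltnS leq_eqVlt => /orP[/eqP pq | pq] i j ij /=.
    by have -> : p = Ordinal qn by [apply: val_inj]; apply: psi_le.
  apply: phi_le => //; move: ij; rewrite leq_eqVlt => /orP[/eqP -> // | ij].
  exact/ltnW/psi_lt.
have [phi phi_lt phi_le] := h n (leqnn n).
exists (phi 0), (phi 1); split; first exact: phi_lt.
by apply/mnm_lepP => p; apply: phi_le.
Qed.
End Dickson.

Section AssociatedPrimes.
Variables (k : fieldType) (N : nat).
Local Notation R := {mpoly k[N]}.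
Implicit Types (V : R -> Prop) (f g r t : R).

Lemma mlead_reduce f g : f != 0 -> (mlead f <= mlead g)%MM ->
  exists q, g - q * f = 0 \/ (mlead (g - q * f) < mlead g)%O.
Proof.
move=> f0 fg; have [g0|g0] := eqVneq g 0; first by exists 0; left; rewrite g0 mul0r subr0.
pose e := mleadc g / mleadc f; pose q := e *: 'X_[mlead g - mlead f] : R.
have e0 : e != 0 by rewrite mulf_neq0 ?invr_eq0 ?mleadc_eq0.
have q0 : q != 0 by rewrite scaler_eq0 negb_or e0 -mleadc_eq0 mleadXm mcoeffX eqxx oner_neq0.
have lq : mlead q = (mlead g - mlead f)%MM by rewrite mleadZ // mleadXm.
have lqf : mlead (q * f) = mlead g by rewrite mleadM // lq submK.
have cqf : (q * f)@_(mlead g) = mleadc g.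
  rewrite -(submK fg) -lq mleadcM lq submK // mcoeffZ mcoeffX eqxx mulr1.
  by rewrite divfK // mleadc_eq0.
exists q; have [|ne] := eqVneq (g - q * f) 0; [by left | right].
rewrite lt_neqAle; apply/andP; split; last first.
  by have := mleadB_le g (q * f); rewrite lqf joinxx.
apply: contra ne => /eqP e1; rewrite -mleadc_eq0 e1 mcoeffB cqf subrr //.
Qed.

(** Along a strictly increasing chain, pick in each ideal an element outside the
    preceding one with the least possible leading monomial. No such leading
    monomial is divisible by an earlier one, since the division would produce
    a smaller one; this contradicts [dickson]. *)
Lemma ascending_chain (I : nat -> R -> Prop) : (forall i, is_ideal (I i)) ->
  (forall i f, I i f -> I i.+1 f) -> exists i, forall f, I i.+1 f -> I i f.
Proof.
move=> idI incI; apply: NNPP => hno.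
have mono i j f : (i <= j)%N -> I i f -> I j f.
  move=> /subnK <-; elim: (j - i)%N => [|d IH] //= If.
  by rewrite addSn; apply: incI; apply: IH.
have ex i : exists f, [/\ I i.+1 f, ~ I i f &
    forall g, I i.+1 g -> ~ I i g -> ~~ (mlead g < mlead f)%O].
  have [f0 [f0I f0nI]] : exists f, I i.+1 f /\ ~ I i f.
    apply: NNPP => h; apply: hno; exists i => f fI; apply: NNPP => fnI.
    by apply: h; exists f.
  have h m : forall f, mlead f = m -> I i.+1 f -> ~ I i f -> exists f, [/\ I i.+1 f, ~ I i f &
    forall g, I i.+1 g -> ~ I i g -> ~~ (mlead g < mlead f)%O].
    elim/(@ltmwf N): m => m IH f fm fI fnI.
    have [[g [gI gnI lt]]|hmin] := classic (exists g, [/\ I i.+1 g, ~ I i g & (mlead g < mlead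
      f)%O]).
      by apply: (IH (mlead g)) gI gnI; rewrite -?fm.
    exists f; split=> // g gI gnI; apply/negP => lt; apply: hmin.
    by exists g.
  exact: (h (mlead f0) f0).
pose f i := proj1_sig (constructive_indefinite_description _ (ex i)).
have fP i : [/\ I i.+1 (f i), ~ I i (f i) &
    forall g, I i.+1 g -> ~ I i g -> ~~ (mlead g < mlead (f i))%O].
  exact: (proj2_sig (constructive_indefinite_description _ (ex i))).
have [i [j [ij le]]] := dickson (fun i => mlead (f i)).
have [fiI fiN _] := fP i; have [fjI fjN fjmin] := fP j.
have fi0 : f i != 0.
  by apply/eqP => fi0; apply: fiN; rewrite fi0; apply: ideal_zero.
have fiJ : I j (f i) by apply: mono fiI.
have [q hq] := mlead_reduce fi0 le.
have gN : ~ I j (f j - q * f i).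
  move=> h; apply: fjN; rewrite -(subrK (q * f i) (f j)).
  by apply: (ideal_add (idI j)) => //; apply: ideal_mull.
case: hq => [g0|lt]; first by apply: gN; rewrite g0; apply: ideal_zero.
have gI : I j.+1 (f j - q * f i).
  by apply: (ideal_sub (idI _)) => //; apply: ideal_mull => //; apply: incI.
by have := fjmin _ gI gN; rewrite lt.
Qed.

Lemma colon_ideal V r : is_ideal V -> is_ideal (fun g => V (g * r)).
Proof.
move=> idV; split; first by rewrite mul0r; apply: ideal_zero.
- by move=> x y; rewrite mulrDl; apply: ideal_add.
- by move=> a x; rewrite -mulrA; apply: ideal_mull.
Qed.

(** If no colon ideal (V : r t) is prime, then each proper one is strictly
    contained in another of the same kind, against the ascending chain
    condition. *)
Lemma associated_prime_exists V r : is_ideal V -> ~ V r ->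
  exists t, prime_ideal (fun g => V (g * (r * t))).
Proof.
move=> idV nVr; apply: NNPP => hno.
have step (t : {t : R | ~ V (r * t)}) : exists t' : {t : R | ~ V (r * t)},
   (forall g, V (g * (r * proj1_sig t)) -> V (g * (r * proj1_sig t'))) /\
   exists g, V (g * (r * proj1_sig t')) /\ ~ V (g * (r * proj1_sig t)).
  case: t => t /= nVt; apply: NNPP => hmax; apply: hno; exists t.
  have [z a m] := colon_ideal (r * t) idV; split=> //; first by rewrite mul1r.
  move=> f g fg; have [|nf] := classic (V (f * (r * t))); [by left | right].
  apply: NNPP => ng; apply: hmax.
  have nf' : ~ V (r * (t * f)) by rewrite mulrA mulrC.
  exists (exist _ (t * f) nf') => /=; split.
    by move=> x Vx; rewrite !mulrA -(mulrA x); apply: ideal_mulr.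
  exists g; split=> //; rewrite (_ : _ * _ = f * g * (r * t)) //; ring.
pose nxt x := proj1_sig (constructive_indefinite_description _ (step x)).
have nxtP x := proj2_sig (constructive_indefinite_description _ (step x)).
have nV1 : ~ V (r * 1) by rewrite mulr1.
pose ts i := iter i nxt (exist _ 1 nV1).
have [i hi] := @ascending_chain (fun i g => V (g * (r * proj1_sig (ts i))))
  (fun i => colon_ideal _ idV) (fun i => proj1 (nxtP (ts i))).
by have [_ [g [g1 g2]]] := nxtP (ts i); apply: g2; apply: hi.
Qed.
End AssociatedPrimes.

(** * Symbolic powers of star configurations *)

Section SymbolicPower.
Variables (k : fieldType) (N s c m : nat) (F : 'I_s -> {mpoly k[N]}).
Local Notation R := {mpoly k[N]}.
Hypothesis nzd : forall (B : {set 'I_s}) j, (#|B| <= c)%N -> j \notin B ->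
  nonzerodivisor (form_ideal F B) (F j).
Implicit Types (f g r x y : R) (A B : {set 'I_s}).
Local Notation I := (star_ideal c F).

Definition cofactor_form B : R := \prod_(j in ~: B) F j.

Lemma cofactor_vars A B : #|A| = c -> #|B| = c -> A <> B -> form_ideal F A (cofactor_form B).
Proof.
move=> cA cB AB; have [j jA jB] : exists2 j, j \in A & j \notin B.
  apply/subsetPn; apply/negP => sAB; apply: AB; apply/eqP.
  by rewrite eqEcard sAB cA cB leqnn.
rewrite /cofactor_form (big_setD1 j) ?inE //=; apply: (ideal_mulr (form_ideal_ideal F A)).
exact: form_ideal_incl.
Qed.

Lemma cofactor_nonzerodivisor B e : (#|B| <= c)%N ->
  nonzerodivisor (form_ideal F B) (cofactor_form B ^+ e).
Proof.
move=> cB; have nM x y : nonzerodivisor (form_ideal F B) x -> nonzerodivisor (form_ideal F B) y ->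
    nonzerodivisor (form_ideal F B) (x * y).
  by move=> nx ny g; rewrite mulrA => /ny /nx.
have n1 : nonzerodivisor (form_ideal F B) 1 by move=> g; rewrite mulr1.
have nh : nonzerodivisor (form_ideal F B) (cofactor_form B).
  apply: (big_ind (nonzerodivisor (form_ideal F B))) => // j.
  by rewrite inE; apply: nzd.
by elim: e => [|e IH]; rewrite ?expr0 // exprS; apply: nM.
Qed.

(** The cofactor form lies in all the other components and is a nonzerodivisor
    modulo the ideal of [B]; multiplication by it turns an associated prime of
    that component into one of the intersection. *)
Lemma star_associated_prime B r : #|B| = c -> ~ form_ideal F B r ->
  exists t, assoc_prime I (fun g => form_ideal F B (g * (r * t))).
Proof.
move=> cB nr; have [t pt] := associated_prime_exists (form_ideal_ideal F B) nr.
exists t; split=> //; exists (r * t * cofactor_form B) => g; split.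
  move=> hg A cA; have [->|AB] := eqVneq A B.
    by rewrite mulrA; apply: (ideal_mulr (form_ideal_ideal F B)).
  rewrite mulrA; apply: (ideal_mull (form_ideal_ideal F A)).
  by apply: cofactor_vars => //; apply/eqP.
move=> /(_ B cB) h; apply: (cofactor_nonzerodivisor (e := 1) (eq_leq cB)).
by rewrite expr1 -mulrA.
Qed.

Lemma mmap1_cofactor B e :
  mmap1 F [multinom if i \in B then 0%N else e | i < s] = cofactor_form B ^+ e.
Proof.
rewrite /mmap1 /cofactor_form -prodrXl [RHS]big_mkcond; apply: eq_bigr => i _.
by rewrite mnmE inE; case: ifP; rewrite ?expr0.
Qed.

Lemma form_ideal_mul_mono_ideal B d x y : mono_ideal F (fun b => d <= weight B b)%N x ->
  form_ideal F B y ->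
  mono_ideal F (fun b => d < weight B b)%N (x * y).
Proof.
have idM := mono_ideal_ideal F (fun b => d < weight B b)%N.
move=> /mono_idealP[r [e [a [ha ->]]]] /form_idealP[t ->]; rewrite mulr_suml.
apply: (ideal_sum idM) => i _; rewrite mulr_sumr; apply: (ideal_sum idM) => j jB.
rewrite mulrACA -(mmap1U F j) -mmap1D; apply: (ideal_mull idM); apply: mono_ideal_incl.
by rewrite weightD (weightU jB) addn1 ltnS; apply: ha.
Qed.

(** The [m]-th power of the ideal of [B] is generated by monomials of weight at
    least [m] on [B]. The factor raises the other exponents to [m], so that any
    other set of [c] positions also has weight at least [m]. *)
Lemma star_pow_mono_ideal B x : #|B| = c -> ideal_pow I m x ->
  mono_ideal F (in_symb c m) (cofactor_form B ^+ m * x).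
Proof.
move=> cB; have idS := mono_ideal_ideal F (in_symb (s := s) c m).
have idC : is_ideal (fun x => mono_ideal F (in_symb (s := s) c m) (cofactor_form B ^+ m * x)).
  split; first by rewrite mulr0; apply: ideal_zero idS.
  - by move=> y z; rewrite mulrDr; apply: ideal_add.
  - by move=> a y; rewrite mulrCA; apply: ideal_mull.
have sub y : mono_ideal F (fun b => m <= weight B b)%N y ->
    mono_ideal F (in_symb c m) (cofactor_form B ^+ m * y).
  apply: (ideal_gen_min idC) => _ [b [hb ->]].
  rewrite -mmap1_cofactor -mmap1D; apply: mono_ideal_incl; apply/in_symbP => A cA.
  have [->|AB] := eqVneq A B.
    by rewrite weightD; apply: leq_trans hb (leq_addl _ _).
  have [j jA jB] : exists2 j, j \in A & j \notin B.
    apply/subsetPn; apply: contra AB => sAB.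
    by rewrite eqEcard sAB cA cB leqnn.
  by rewrite /weight (big_setD1 j jA) /= mnmDE mnmE (negPf jB) -!addnA leq_addr.
apply: (ideal_gen_min idC) => _ [g [gI ->]]; apply: sub.
elim: m g gI => [|d IH] g gI.
  by rewrite big_ord0 -(mmap11 F); apply: mono_ideal_incl.
rewrite big_ord_recr; apply: form_ideal_mul_mono_ideal; last exact: gI.
by apply: IH => i; apply: gI.
Qed.

Lemma ideal_pow_mul (J : R -> Prop) d x y :
  ideal_pow J d x -> J y -> ideal_pow J d.+1 (x * y).
Proof.
move=> hx Jy; move: x hx; apply: (ideal_gen_min (I := fun x => ideal_pow J d.+1 (x * y))).
  exact: (colon_ideal y (ideal_gen_ideal _)).
move=> _ [g [gJ ->]]; apply: ideal_gen_incl.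
exists (fun i : 'I_d.+1 => if unlift ord_max i is Some j then g j else y); split.
  by move=> i; case: (unlift ord_max i).
rewrite big_ord_recr /= unlift_none; congr (_ * _); apply: eq_bigr => i _.
rewrite (_ : widen_ord _ i = lift ord_max i) ?liftK //.
by apply: val_inj; rewrite /= /bump leqNgt ltn_ord.
Qed.

(** A variable of [A] times the cofactor form of [A] lies in all components, and
    [d] such products can be split off. *)
Lemma cofactor_mmap1_pow A d b : #|A| = c -> (d <= weight A b)%N ->
  ideal_pow I d (cofactor_form A ^+ d * mmap1 F b).
Proof.
move=> cA; elim: d b => [|d IH] b hb.
  have h1 : ideal_pow I 0 1 by apply: ideal_gen_incl; exists (fun=> 0); split;
    [case | rewrite big_ord0].
  by rewrite -[_ * _]mulr1; apply: (ideal_mull (ideal_gen_ideal _)).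
have [i iA bi] : exists2 i, i \in A & (0 < b i)%N.
  apply: NNPP => h; move: hb; rewrite /weight big1 // => i iA.
  by apply/eqP; rewrite -leqn0 leqNgt; apply/negP => bi; apply: h; exists i.
have ib : (U_(i) <= b)%MM by rewrite lep1mP -lt0n.
rewrite (mmap1B F ib) mmap1U exprSr.
rewrite (_ : _ * _ = cofactor_form A ^+ d * mmap1 F (b - U_(i))%MM * (cofactor_form A * F i));
  last by ring.
apply: ideal_pow_mul.
  by apply: IH; move: hb; rewrite -{1}(submK ib) weightD (weightU iA) addn1 ltnS.
move=> A' cA'; have [->|A'A] := eqVneq A' A.
  by apply: (ideal_mull (form_ideal_ideal F A)); apply: form_ideal_incl.
by apply: (ideal_mulr (form_ideal_ideal F A')); apply: cofactor_vars => //; apply/eqP.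
Qed.

(** An associated prime [P] of the intersection is associated to one of the
    components, by primality, and then contains no form outside that
    component, as these are nonzerodivisors modulo it. *)
Lemma star_prime_component P : assoc_prime I P ->
  exists2 A : {set 'I_s}, #|A| = c & forall e, ~ P (cofactor_form A ^+ e).
Proof.
case=> -[P0 PD PM P1 Pprime] [f0 Pf0].
have [A [cA hA]] : exists A : {set 'I_s}, #|A| = c /\ forall g, form_ideal F A (g * f0) -> P g.
  apply: NNPP => hno.
  have ex (A : {set 'I_s}) : exists g, ~ P g /\ (#|A| = c -> form_ideal F A (g * f0)).
    have [cA|cA] := eqVneq #|A| c; last by exists 1; split=> //; move/eqP: cA.
    apply: NNPP => h; apply: hno; exists A; split=> // g hg.
    by apply: NNPP => nPg; apply: h; exists g.
  pose G A := proj1_sig (constructive_indefinite_description _ (ex A)).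
  have GP A := proj2_sig (constructive_indefinite_description _ (ex A)).
  have nP : ~ P (\prod_A G A).
    apply: (big_ind (fun x => ~ P x)) => // [x y nx ny /Pprime[] // | A _].
    by case: (GP A).
  apply: nP; apply/Pf0 => A cA; rewrite (bigD1 A) //= mulrAC.
  by apply: (ideal_mulr (form_ideal_ideal F A)); case: (GP A) => _; apply.
exists A => // e; have nF j : j \in ~: A -> ~ P (F j).
  rewrite inE => jA /Pf0/(_ A cA); rewrite mulrC => /(nzd (eq_leq cA) jA) h.
  by apply: P1; apply: hA; rewrite mul1r.
have nM x y : ~ P x -> ~ P y -> ~ P (x * y) by move=> nx ny /Pprime[].
elim: e => [|e IH]; rewrite ?expr0 // exprS; apply: (nM) => //.
by apply: (big_ind (fun x => ~ P x)); [exact: P1 | exact: nM | exact: nF].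
Qed.

Lemma mono_ideal_symbolic_power f : mono_ideal F (in_symb c m) f -> symbolic_power I m f.
Proof.
move=> /mono_idealP[r [e [a [ha ->]]]] P aP; have [A cA nP] := star_prime_component aP.
exists (cofactor_form A ^+ m); split; first exact: nP.
have idI : is_ideal (ideal_pow I m) by apply: ideal_gen_ideal.
rewrite mulr_sumr; apply: (ideal_sum idI) => i _; rewrite mulrCA.
apply: (ideal_mull idI); apply: cofactor_mmap1_pow => //.
by have /in_symbP := ha i; apply.
Qed.

(** An element of the symbolic power lies in the unit ideal, where the
    filtration ends, and descends through each of its steps. At the step of [u]
    write f = g + r F^u. If [r] were not in the ideal of [B], then for some
    [t] the elements [x] with [x * (r * t)] in that ideal would form an
    associated prime of the star configuration. Take [v] outside it with [v * f]
    in the ordinary power. By [star_pow_mono_ideal] a multiple of [v * f] by a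
    power of the cofactor form lies in the smaller ideal, and the colon ideal
    of [u] then puts [v * r] into the ideal of [B], so [v] into the prime. *)
Lemma symbolic_power_descent pre ws f : filtration pre ws ->
  (forall w, w \in ws -> #|w.2| = c) ->
  upset (catrev (unzip1 ws) pre) 0%MM -> (forall a, in_symb c m a -> upset pre a) ->
  symbolic_power I m f -> mono_ideal F (upset pre) f.
Proof.
move=> fil wc up0 sub hf; elim: ws pre fil wc up0 sub => [|[u B] ws IH] pre fil wc up0 sub.
  by rewrite -[f]mulr1 -(mmap11 F); apply: (ideal_mull (mono_ideal_ideal F _));
    apply: mono_ideal_incl.
have cB : #|B| = c by apply: (wc (u, B)); rewrite mem_head.
case: (fil) => /= incl only fil'.
have wc' w : w \in ws -> #|w.2| = c by move=> wws; apply: wc; rewrite inE wws orbT.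
have T : tor1_zero F (upset (u :: pre)).
  apply: (filtration_tor1 nzd) fil' up0 => w /wc' ->; lia.
have fU : mono_ideal F (upset (u :: pre)) f.
  by apply: IH => // a ha; rewrite upset_cons sub.
have stp := mono_ideal_step F (upset_cons u pre) f.
have [g [r [Ug fE]]] := proj1 stp fU.
have idU := mono_ideal_ideal F (upset pre).
have only' b := upset_colon (b := b) only.
rewrite fE; apply: (ideal_add idU) => //.
have [hr|nr] := classic (form_ideal F B r); first exact: mono_ideal_colon_incl incl _ hr.
have [t aP] := star_associated_prime cB nr.
have [v [nv vf]] := hf _ aP; case: nv.
have h1 : mono_ideal F (upset pre) (cofactor_form B ^+ m * (v * f)).
  by apply: (mono_ideal_mono sub); apply: star_pow_mono_ideal.
have h2 : mono_ideal F (upset pre) (cofactor_form B ^+ m * v * r * mmap1 F u).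
  rewrite (_ : _ * _ = cofactor_form B ^+ m * (v * f) - cofactor_form B ^+ m * v * g).
    by apply: (ideal_sub idU) => //; apply: (ideal_mull idU).
  by rewrite fE; ring.
have := mono_ideal_colon (@upset_add _ pre) (upset_cons u pre) only' T h2.
rewrite -mulrA mulrC => /(cofactor_nonzerodivisor (eq_leq cB)) h3.
by rewrite mulrA; apply: (ideal_mulr (form_ideal_ideal F B)).
Qed.
End SymbolicPower.

(** * Koszul homology of the variables *)

Section Koszul.
Variables (k : fieldType) (N : nat).
Local Notation R := {mpoly k[N]}.
Implicit Types (L : lmodType R) (l : seq 'I_N) (p j d : int).

(** The Koszul complex of the variables listed in [l] with coefficients in [L],
    as an iterated mapping cone and with all its homological degrees summed:
    in a pair (z1, z2), the second component carries the basis element of the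
    first variable. *)
Fixpoint kos L l : lmodType R :=
  if l is _ :: l' then (kos L l' * kos L l')%type else L.

Fixpoint kos_d L l : kos L l -> kos L l :=
  match l with
  | [::] => fun=> 0
  | i :: l' => fun z => (kos_d z.1 + 'X_i *: z.2, - kos_d z.2)
  end.

Fixpoint kos_map L1 L2 (phi : L1 -> L2) l : kos L1 l -> kos L2 l :=
  match l with
  | [::] => phi
  | i :: l' => fun z => (kos_map phi z.1, kos_map phi z.2)
  end.

Fixpoint kos_in L (V : L -> Prop) l : kos L l -> Prop :=
  match l with
  | [::] => V
  | i :: l' => fun z => kos_in V z.1 /\ kos_in V z.2
  end.

Fixpoint kos_bottom L l : kos L l -> L :=
  match l with
  | [::] => id
  | i :: l' => fun z => kos_bottom z.1
  end.

Fixpoint kos_inj L l : L -> kos L l :=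
  match l with
  | [::] => id
  | i :: l' => fun x => (kos_inj l' x, 0)
  end.

(** The projection onto homological degree [p] and internal degree [j], where
    [pr] is the family of projections of [L] onto its graded pieces. Degrees are
    integers so that the shifts by one need no case distinction. *)
Fixpoint kos_pr L (pr : int -> L -> L) l : int -> int -> kos L l -> kos L l :=
  match l with
  | [::] => fun p j x => if p == 0 then pr j x else 0
  | i :: l' => fun p j z => (kos_pr pr p j z.1, kos_pr pr (p - 1) (j - 1) z.2)
  end.

Definition linear_fun L1 L2 (phi : L1 -> L2) : Prop :=
  forall a x y, phi (a *: x + y) = a *: phi x + phi y.

Section LinearFun.
Variables (L1 L2 : lmodType R) (phi : L1 -> L2).
Hypothesis lphi : linear_fun phi.
Lemma linear_fun0 : phi 0 = 0.
Proof. by have := lphi (-1) 0 0; rewrite scaleN1r oppr0 addr0 scaleN1r addNr. Qed.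
Lemma linear_funD x y : phi (x + y) = phi x + phi y.
Proof. by rewrite -[x in LHS]scale1r lphi scale1r. Qed.
Lemma linear_funZ a x : phi (a *: x) = a *: phi x.
Proof. by rewrite -[_ *: x]addr0 lphi linear_fun0 addr0. Qed.
Lemma linear_funN x : phi (- x) = - phi x.
Proof. by rewrite -!scaleN1r linear_funZ. Qed.
Lemma linear_funB x y : phi (x - y) = phi x - phi y.
Proof. by rewrite linear_funD linear_funN. Qed.
Lemma linear_fun_sum (T : Type) (r : seq T) (f : T -> L1) :
  phi (\sum_(i <- r) f i) = \sum_(i <- r) phi (f i).
Proof. by apply: big_morph; [exact: linear_funD | exact: linear_fun0]. Qed.
End LinearFun.

Lemma pairE (L1 L2 : lmodType R) (z : (L1 * L2)%type) x y : z.1 = x -> z.2 = y -> z = (x, y).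
Proof. by case: z => /= ? ? -> ->. Qed.

Lemma kos_d_linear L l : linear_fun (@kos_d L l).
Proof.
elim: l => [|i l IH] a x y /=; first by rewrite scaler0 addr0.
apply/esym/pairE => /=.
  by rewrite IH !scalerDr !scalerA addrACA [a * _]mulrC.
by rewrite IH opprD scalerN.
Qed.

Lemma kos_dK L l (z : kos L l) : kos_d (kos_d z) = 0.
Proof.
elim: l z => //= i l IH z; apply/esym/pairE => /=.
  by rewrite (linear_funD (@kos_d_linear L l)) IH add0r (linear_funZ (@kos_d_linear L l))
    scalerN addrN.
by rewrite (linear_funN (@kos_d_linear L l)) IH oppr0 oppr0.
Qed.

Lemma kos_map_linear L1 L2 (phi : L1 -> L2) l : linear_fun phi -> linear_fun (@kos_map L1 L2 phi l).
Proof.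
by move=> lphi; elim: l => //= i l IH a x y; apply/esym/pairE; rewrite /= IH.
Qed.

Lemma kos_d_kos_map L1 L2 (phi : L1 -> L2) l (z : kos L1 l) : linear_fun phi ->
  kos_d (kos_map phi z) = kos_map phi (kos_d z).
Proof.
move=> lphi; elim: l z => [|i l IH] z /=; first by rewrite (linear_fun0 lphi).
have lk := @kos_map_linear L1 L2 phi l lphi.
by rewrite (linear_funD lk) (linear_funZ lk) (linear_funN lk) !IH.
Qed.

Lemma kos_inj_linear L l : linear_fun (@kos_inj L l).
Proof.
elim: l => //= i l IH a x y; apply/esym/pairE; rewrite /= ?IH //.
by rewrite scaler0 addr0.
Qed.

Lemma kos_bottom_linear L l : linear_fun (@kos_bottom L l).
Proof. by elim: l => //= i l IH a x y; rewrite IH. Qed.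

Lemma kos_d_kos_inj L l x : kos_d (@kos_inj L l x) = 0.
Proof.
elim: l => //= i l IH; rewrite IH scaler0 addr0.
by rewrite (linear_fun0 (@kos_d_linear L l)) oppr0.
Qed.

Lemma kos_bottom_kos_inj L l x : kos_bottom (@kos_inj L l x) = x.
Proof. by elim: l. Qed.

Lemma kos_map_kos_inj L1 L2 (phi : L1 -> L2) l x : linear_fun phi ->
  kos_map phi (@kos_inj L1 l x) = kos_inj l (phi x).
Proof.
move=> lphi; elim: l => //= i l ->.
by rewrite (linear_fun0 (@kos_map_linear L1 L2 phi l lphi)).
Qed.

Section Submodules.
Variables (L : lmodType R) (V : L -> Prop).
Hypothesis sV : submod V.

Lemma kos_in_submod l : submod (@kos_in L V l).
Proof.
elim: l => //= i l [h0 hD hZ]; split=> //.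
- by move=> x y [? ?] [? ?]; split; apply: hD.
- by move=> a x [? ?]; split; apply: hZ.
Qed.

Lemma kos_in_kos_d l (z : kos L l) : kos_in V z -> kos_in V (kos_d z).
Proof.
elim: l z => [|i l IH] z /=; first by move=> _; apply: submod0.
case=> h1 h2; have sl := kos_in_submod l; split; last by apply: submodN => //; apply: IH.
by apply: submodD => //; [apply: IH | apply: submodZ].
Qed.

(** Only the part of homological degree 1 contributes to the bottom component of
    a boundary, and it is multiplied by the variables. *)
Lemma kos_bottom_kos_d_in (V' : L -> Prop) l (z : kos L l) : submod V' ->
  (forall i x, V x -> V' ('X_i *: x)) -> kos_in V z -> V' (kos_bottom (kos_d z)).
Proof.
move=> sV' h; elim: l z => [|i l IH] z /=; first by move=> _; apply: submod0.
case=> h1 h2; rewrite (linear_funD (@kos_bottom_linear L l)) (linear_funZ (@kos_bottom_linear L l)).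
apply: submodD => //; [exact: IH | apply: h].
by elim: l z h1 h2 {IH} => //= i' l IH z [h11 h12] [h21 h22]; apply: (IH (z.1.1, z.2.1)).
Qed.
End Submodules.

Lemma kos_in_mono L (V V' : L -> Prop) l (z : kos L l) :
  (forall x, V x -> V' x) -> kos_in V z -> kos_in V' z.
Proof. by move=> h; elim: l z => /= [|i l IH] z; [apply: h | case=> *; split; apply: IH]. Qed.

Lemma kos_in_kos_map L1 L2 (phi : L1 -> L2) (V1 : L1 -> Prop) (V2 : L2 -> Prop) l (z : kos L1 l) :
  (forall x, V1 x <-> V2 (phi x)) -> kos_in V1 z <-> kos_in V2 (kos_map phi z).
Proof. by move=> h; elim: l z => [|i l IH] z //=; rewrite !IH. Qed.

Lemma kos_in_lift L1 L2 (phi : L1 -> L2) (V V' : L2 -> Prop) l (z : kos L2 l) :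
  (forall y, V' y -> exists v w, V v /\ y = v + phi w) -> kos_in V' z ->
  exists v w, kos_in V v /\ z = v + kos_map phi w.
Proof.
move=> h; elim: l z => [|i l IH] z /=; first exact: h.
case=> /IH[v1 [w1 [Vv1 e1]]] /IH[v2 [w2 [Vv2 e2]]].
by exists (v1, v2), (w1, w2); split=> //; rewrite [z]surjective_pairing e1 e2.
Qed.

Lemma kos_in0 L l (z : kos L l) : kos_in (fun x : L => x = 0) z <-> z = 0.
Proof.
elim: l z => [|i l IH] z //=; rewrite !IH; split=> [[h1 h2] | ->] //.
by rewrite [z]surjective_pairing h1 h2.
Qed.

(** * Gradings *)

Definition is_grading L (pr : int -> L -> L) : Prop :=
  [/\ forall j x y, pr j (x + y) = pr j x + pr j y,
      forall j i x, pr j ('X_i *: x) = 'X_i *: pr (j - 1) x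
    & forall j x, pr j (pr j x) = pr j x].

Section Grading.
Variables (L : lmodType R) (pr : int -> L -> L).
Hypothesis gr : is_grading pr.

Lemma kos_prD l p j (x y : kos L l) : kos_pr pr p j (x + y) = kos_pr pr p j x + kos_pr pr p j y.
Proof.
case: gr => grD _ _; elim: l p j x y => [|i l IH] p j x y /=.
  by case: ifP; rewrite ?addr0.
by rewrite !IH.
Qed.

Lemma kos_pr0 l p j : kos_pr pr p j (0 : kos L l) = 0.
Proof. by apply: (addIr (kos_pr pr p j 0)); rewrite -kos_prD !add0r. Qed.

Lemma kos_prN l p j (x : kos L l) : kos_pr pr p j (- x) = - kos_pr pr p j x.
Proof. by apply: (addIr (kos_pr pr p j x)); rewrite -kos_prD !addNr kos_pr0. Qed.

Lemma kos_prB l p j (x y : kos L l) : kos_pr pr p j (x - y) = kos_pr pr p j x - kos_pr pr p j y.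
Proof. by rewrite kos_prD kos_prN. Qed.

Lemma kos_prX l p j i (x : kos L l) : kos_pr pr p j ('X_i *: x) = 'X_i *: kos_pr pr p (j - 1) x.
Proof.
case: gr => _ grX _; elim: l p j x => [|i' l IH] p j x /=.
  by case: ifP => _; rewrite ?scaler0.
by rewrite !IH.
Qed.

Lemma kos_prK l p j (x : kos L l) : kos_pr pr p j (kos_pr pr p j x) = kos_pr pr p j x.
Proof.
case: gr => _ _ grK; elim: l p j x => [|i' l IH] p j x /=; last by rewrite !IH.
by case: (p == 0); rewrite ?grK.
Qed.

Lemma kos_d_kos_pr l p j (z : kos L l) : kos_d (kos_pr pr p j z) = kos_pr pr (p - 1) j (kos_d z).
Proof.
elim: l p j z => [|i l IH] p j z /=; last by rewrite !IH kos_prD kos_prX kos_prN.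
by case: ifP => //; case: gr => grD _ _ _; rewrite -[LHS](subrr (pr j 0)) -{1}[0]addr0 grD addrK.
Qed.

Lemma kos_in_kos_pr (V : L -> Prop) l p j (z : kos L l) : V 0 ->
  (forall j x, V x -> V (pr j x)) -> kos_in V z -> kos_in V (kos_pr pr p j z).
Proof.
move=> V0 h; elim: l p j z => [|i l IH] p j z /=; last by case=> *; split; apply: IH.
by case: ifP => // _; apply: h.
Qed.

Lemma kos_pr_lt0 l p j (z : kos L l) : (p < 0) -> kos_pr pr p j z = 0.
Proof.
elim: l p j z => [|i l IH] p j z /= p0; first by rewrite lt_eqF.
by rewrite !IH //; lia.
Qed.

Lemma kos_pr_kos_inj l j x : kos_pr pr 0 j (kos_inj l x) = kos_inj l (pr j x).
Proof. by elim: l => //= i l ->; rewrite kos_pr0. Qed.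

Lemma kos_pr0_kos_inj l j (z : kos L l) : kos_pr pr 0 j z = z ->
  exists2 x, z = kos_inj l x & pr j x = x.
Proof.
elim: l j z => [|i l IH] j z /=; first by exists z.
case: z => z1 z2 /= [/IH[x -> hx]]; rewrite kos_pr_lt0 // => <-.
by exists x.
Qed.

End Grading.

Lemma kos_map_kos_pr L1 L2 (pr1 : int -> L1 -> L1) (pr2 : int -> L2 -> L2) (phi : L1 -> L2) d l p j
    (z : kos L1 l) : linear_fun phi ->
  (forall j x, phi (pr1 j x) = pr2 (j + d) (phi x)) ->
  kos_map phi (kos_pr pr1 p j z) = kos_pr pr2 p (j + d) (kos_map phi z).
Proof.
move=> lphi h; elim: l p j z => [|i l IH] p j z /=.
  by case: ifP => _; rewrite ?h // linear_fun0.
by rewrite !IH addrAC.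
Qed.

(** * Vanishing of Koszul homology *)

(** The Koszul homology of the quotient of [L] by [V] is zero in homological
    degree [p] and internal degree [j]. Quotients are avoided throughout: cycles
    and boundaries are taken in the complex of [L], modulo that of [V]. *)
Definition koszul_zero L (pr : int -> L -> L) l (V : L -> Prop) p j : Prop :=
  forall z : kos L l, kos_pr pr p j z = z -> kos_in V (kos_d z) -> exists w, kos_in V (z - kos_d w).

Lemma koszul_zero_homog L (pr : int -> L -> L) l (V : L -> Prop) p j (z : kos L l) :
  is_grading pr -> submod V -> (forall j x, V x -> V (pr j x)) ->
  koszul_zero pr l V p j -> kos_pr pr p j z = z -> kos_in V (kos_d z) ->
  exists2 w, kos_pr pr (p + 1) j w = w & kos_in V (z - kos_d w).
Proof.
move=> gr sV gV van hz Vz; have [w hw] := van z hz Vz.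
exists (kos_pr pr (p + 1) j w); first exact: kos_prK.
rewrite kos_d_kos_pr // addrK -hz -kos_prB //; apply: kos_in_kos_pr => //.
by case: sV.
Qed.

Section ExactSequence.
Variables (L1 L2 : lmodType R) (pr1 : int -> L1 -> L1) (pr2 : int -> L2 -> L2).
Variables (phi : L1 -> L2) (d : int) (V1 : L1 -> Prop) (V2 V2' : L2 -> Prop) (l : seq 'I_N).
Hypotheses (gr1 : is_grading pr1) (gr2 : is_grading pr2) (lphi : linear_fun phi)
  (phi_pr : forall j x, phi (pr1 j x) = pr2 (j + d) (phi x))
  (sV2 : submod V2) (gV2 : forall j x, V2 x -> V2 (pr2 j x))
  (V1E : forall x, V1 x <-> V2 (phi x))
  (V2'E : forall y, V2' y <-> exists v w, V2 v /\ y = v + phi w).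

Let sV1 : submod V1.
Proof.
split.
- by apply/V1E; rewrite (linear_fun0 lphi); apply: submod0.
- by move=> x y /V1E hx /V1E hy; apply/V1E; rewrite (linear_funD lphi); apply: submodD.
- by move=> a x /V1E hx; apply/V1E; rewrite (linear_funZ lphi); apply: submodZ.
Qed.

Let gV1 : forall j x, V1 x -> V1 (pr1 j x).
Proof. by move=> j x /V1E hx; apply/V1E; rewrite phi_pr; apply: gV2. Qed.

Let sV2' : submod V2'.
Proof.
split.
- by apply/V2'E; exists 0, 0; rewrite (linear_fun0 lphi) addr0; split=> //; apply: submod0.
- move=> x y /V2'E[v [w [hv ->]]] /V2'E[v' [w' [hv' ->]]]; apply/V2'E.
  exists (v + v'), (w + w'); rewrite (linear_funD lphi) addrACA; split=> //.
  exact: submodD.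
- move=> a x /V2'E[v [w [hv ->]]]; apply/V2'E.
  by exists (a *: v), (a *: w); rewrite (linear_funZ lphi) scalerDr; split=> //; apply: submodZ.
Qed.

Let V2_sub y : V2 y -> V2' y.
Proof. by move=> hy; apply/V2'E; exists y, 0; rewrite (linear_fun0 lphi) addr0. Qed.

Let kos_in_phi (w : kos L1 l) : kos_in V2' (kos_map phi w).
Proof.
apply/(@kos_in_kos_map _ _ phi (fun=> True) V2'); last by elim: l w => //= i l' IH w.
move=> x; split=> // _; apply/V2'E; exists 0, x; rewrite add0r.
by split=> //; apply: submod0.
Qed.

Let lk := @kos_map_linear L1 L2 phi l lphi.
Let ld2 := @kos_d_linear L2 l.

(** The hypotheses describe a short exact sequence
    0 -> L1/V1 -> L2/V2 -> L2/V2' -> 0, where the first map has degree [d]. This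
    lemma and the next are two pieces of its long exact homology sequence, by
    the usual diagram chase. *)
Lemma koszul_zero_cokernel p j : koszul_zero pr2 l V2 p j -> koszul_zero pr1 l V1 (p - 1) (j - d) ->
  koszul_zero pr2 l V2' p j.
Proof.
move=> van2 van1 z hz Vz.
have [v0 [w0 [Vv0 dz0]]] := kos_in_lift (fun y => proj1 (V2'E y)) Vz.
pose v := kos_pr pr2 (p - 1) j v0; pose w := kos_pr pr1 (p - 1) (j - d) w0.
have Vv : kos_in V2 v by apply: kos_in_kos_pr => //; apply: submod0.
have dz : kos_d z = v + kos_map phi w.
  by rewrite /w (kos_map_kos_pr _ _ _ lphi phi_pr) subrK -kos_prD // -dz0 -kos_d_kos_pr // hz.
have Vdw : kos_in V1 (kos_d w).
  apply/(kos_in_kos_map _ V1E); rewrite -kos_d_kos_map // (_ : kos_d _ = - kos_d v).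
    by apply: submodN; [apply: kos_in_submod | apply: kos_in_kos_d].
  by apply/eqP; rewrite -subr_eq0 opprK addrC -(linear_funD ld2) -dz kos_dK.
have [||y hy Vwy] := koszul_zero_homog gr1 sV1 gV1 van1 (z := w); [exact: kos_prK | by [] |].
rewrite subrK in hy; have hzy : kos_pr pr2 p j (z - kos_map phi y) = z - kos_map phi y.
  by rewrite kos_prB // hz -[in LHS](subrK d j) -(kos_map_kos_pr _ _ _ lphi phi_pr) hy.
have Vzy : kos_in V2 (kos_d (z - kos_map phi y)).
  rewrite (linear_funB ld2) dz kos_d_kos_map // -addrA -(linear_funB lk).
  by apply: (submodD (kos_in_submod sV2 l)) => //; apply/(kos_in_kos_map _ V1E).
have [y' hy'] := van2 _ hzy Vzy; exists y'.
rewrite (_ : z - kos_d y' = z - kos_map phi y - kos_d y' + kos_map phi y);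
  last by rewrite addrAC subrK.
apply: (submodD (kos_in_submod sV2' l)) => //.
exact: kos_in_mono hy'.
Qed.

Lemma koszul_zero_kernel p j : koszul_zero pr2 l V2' (p + 1) j -> koszul_zero pr2 l V2 p j ->
  koszul_zero pr1 l V1 p (j - d).
Proof.
move=> van2' van2 z hz Vz.
have hpz : kos_pr pr2 p j (kos_map phi z) = kos_map phi z.
  by rewrite -[in LHS](subrK d j) -(kos_map_kos_pr _ _ _ lphi phi_pr) hz.
have Vpz : kos_in V2 (kos_d (kos_map phi z)) by rewrite kos_d_kos_map //;
  apply/(kos_in_kos_map _ V1E).
have [y hy Vzy] := koszul_zero_homog gr2 sV2 gV2 van2 hpz Vpz.
have Vdy : kos_in V2' (kos_d y).
  apply: (submodBl (kos_in_submod sV2' l) (x := kos_map phi z)) => //.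
  exact: kos_in_mono Vzy.
have [y' Vy'] := van2' y hy Vdy.
have [v [w [Vv e]]] := kos_in_lift (fun y => proj1 (V2'E y)) Vy'.
exists w; apply/(kos_in_kos_map _ V1E); rewrite (linear_funB lk) -kos_d_kos_map //.
have -> : kos_map phi w = y - kos_d y' - v by rewrite e addrC addKr.
rewrite !(linear_funB ld2) kos_dK subr0 opprB addrCA addrC.
by apply: (submodD (kos_in_submod sV2 l)) => //; apply: kos_in_kos_d.
Qed.
End ExactSequence.

End Koszul.

(** * Acyclicity of the Koszul complex of a free module *)

Section Acyclicity.
Variables (k : fieldType) (N : nat).
Local Notation R := {mpoly k[N]}.
Implicit Types (x y : R) (l : seq 'I_N) (p j : int).

Definition pih j (x : R^o) : R^o := if j is Posz d then pihomog mdeg d x else 0.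

Lemma pih0 j : pih j 0 = 0.
Proof. by case: j => d //=; rewrite linear0. Qed.

Lemma pihD j x y : pih j (x + y) = pih j x + pih j y.
Proof. by case: j => d /=; rewrite ?linearD ?addr0. Qed.

Lemma pih_sum (T : Type) (r : seq T) (f : T -> R) j :
  pih j (\sum_(i <- r) f i) = \sum_(i <- r) pih j (f i).
Proof. by apply: big_morph => [x y|]; [apply: pihD | apply: pih0]. Qed.

Lemma pihK j x : pih j (pih j x) = pih j x.
Proof. by case: j => d //=; rewrite pihomog_id. Qed.

Lemma pihMl j e x y : y \is e.-homog -> pih j (x * y) = pih (j - e%:Z) x * y.
Proof.
move=> hy; case: j => d /=.
  rewrite (pihomogMl _ _ hy); case: leqP => ed; first by rewrite subzn.
  by rewrite /pih; case E: (d%:Z - e%:Z) => [q|q] //; move: E; lia.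
by rewrite /pih; case E: (_ - _) => [q|q]; rewrite ?mul0r //; move: E; lia.
Qed.

Lemma dhomogXi i : ('X_i : R) \is 1.-homog.
Proof. by rewrite dhomogX; apply/eqP; exact: mdeg1. Qed.

Lemma pih_grading : @is_grading k N R^o pih.
Proof.
split; [exact: pihD | | exact: pihK].
by move=> j i x; rewrite [_ *: _]mulrC (pihMl _ _ (dhomogXi i)) mulrC.
Qed.

(** Membership in the ideal generated by the variables of [l], which can be
    tested monomial by monomial. *)
Definition in_vars l x : Prop := forall m, m \in msupp x -> exists2 i, i \in l & m i != 0%N.

Lemma in_vars0 l : in_vars l 0.
Proof. by move=> m; rewrite msupp0. Qed.

Lemma in_varsD l x y : in_vars l x -> in_vars l y -> in_vars l (x + y).
Proof. by move=> hx hy m /msuppD_le; rewrite mem_cat => /orP[/hx | /hy]. Qed.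

Lemma in_varsX l i x : i \in l -> in_vars l ('X_i * x).
Proof.
move=> il m; rewrite mulrC (perm_mem (msuppMX _ _)) => /mapP[m' _ ->].
by exists i => //; rewrite mnmDE mnm1E eqxx.
Qed.

Lemma in_vars_regular l i x : i \notin l -> in_vars l ('X_i * x) -> in_vars l x.
Proof.
move=> il h m mx; have [|j jl] := h (U_(i) + m)%MM.
  by rewrite mulrC mcoeff_msupp mcoeffMX -mcoeff_msupp.
rewrite mnmDE mnm1E; have [ij|_] := eqVneq i j; first by rewrite ij jl in il.
by exists j.
Qed.

Lemma in_vars_split l i x : in_vars (i :: l) x ->
  exists x' t, in_vars l x' /\ x = x' + 'X_i * t.
Proof.
move=> h; rewrite [x]mpolyE big_seq.
apply: (big_ind (fun y => exists x' t, in_vars l x' /\ y = x' + 'X_i * t)).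
- by exists 0, 0; rewrite mulr0 addr0; split=> //; apply: in_vars0.
- move=> _ _ [x1 [t1 [h1 ->]]] [x2 [t2 [h2 ->]]]; exists (x1 + x2), (t1 + t2).
  by rewrite mulrDr addrACA; split=> //; apply: in_varsD.
move=> m /h[j jl mj]; have [mi|mi] := eqVneq (m i) 0%N.
  exists (x@_m *: 'X_[m]), 0; rewrite mulr0 addr0; split=> // m' /msuppZ_le.
  rewrite msuppX inE => /eqP ->; exists j => //.
  by move: jl; rewrite inE => /orP[/eqP ji|//]; rewrite ji mi in mj.
exists 0, (x@_m *: 'X_[m - U_(i)]); rewrite add0r; split; first exact: in_vars0.
by rewrite -scalerAr -mpolyXD addmC submK // lep1mP.
Qed.

Lemma kos_bottom_kos_d_in_vars l (w : kos R^o l) : in_vars l (kos_bottom (kos_d w)).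
Proof.
elim: l w => [|i l IH] w /=; first exact: in_vars0.
have sub : forall y, in_vars l y -> in_vars (i :: l) y.
  by move=> y hy m /hy[j jl mj]; exists j => //; rewrite inE jl orbT.
rewrite (linear_funD (@kos_bottom_linear k N R^o l)) (linear_funZ (@kos_bottom_linear k N R^o l)).
by apply: in_varsD; [apply: sub;
  apply: IH | exact: (@in_varsX (i :: l) i (kos_bottom w.2) (mem_head i l))].
Qed.

Lemma kos_inj_boundary l x : in_vars l x -> exists w : kos R^o l, kos_d w = kos_inj l (x : R^o).
Proof.
elim: l x => [|i l IH] x /=.
  move=> h; exists 0; apply/esym/eqP; rewrite -msupp_eq0; move: h; rewrite /in_vars.
  by case: (msupp x) => // m s h; case: (h m (mem_head m s)).
case/in_vars_split=> x' [t [/IH[w dw] ->]].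
exists (w, kos_inj l (t : R^o)); rewrite kos_d_kos_inj oppr0 dw.
have lj := @kos_inj_linear k N R^o l; rewrite -(linear_funZ lj) -(linear_funD lj).
by [].
Qed.

(** The Koszul complex on [i :: l] is the cone of the multiplication by the
    variable of [i] on the one on [l]. So a class can survive only in degrees 0
    and 1, and in degree 1 it is excluded because that variable is regular
    modulo those of [l]. *)
Lemma kos_exact l p j (z : kos R^o l) : uniq l -> p != 0 -> kos_pr (L := R^o) pih p j z = z ->
  kos_d z = 0 -> exists w, z = kos_d w.
Proof.
have gr := pih_grading; elim: l p j z => [|i l IH] p j z /=.
  by move=> _ /negPf ->; exists 0.
case: z => u v /= /andP[il ul] p0 [hu hv] [duv /eqP]; rewrite oppr_eq0 => /eqP dv.
have ld := @kos_d_linear k N R^o l.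
have [v' hv' vE] : exists2 v', kos_pr (L := R^o) pih p (j - 1) v' = v' & v = kos_d v'.
  suff [v0 v0E] : exists v0, v = kos_d v0.
    exists (kos_pr (L := R^o) pih p (j - 1) v0); first exact: kos_prK.
    by rewrite kos_d_kos_pr // -v0E hv.
  have [p1|p1] := eqVneq (p - 1) 0; last by apply: IH hv dv.
  move: hv; rewrite p1 => /kos_pr0_kos_inj[x vx _].
  have [v0 v0E] : exists w : kos R^o l, kos_d w = kos_inj l x.
    apply: kos_inj_boundary; apply: (in_vars_regular il).
    have -> : 'X_i * x = - kos_bottom (kos_d u).
      have := congr1 (@kos_bottom k N R^o l) duv.
      rewrite vx (linear_funD (@kos_bottom_linear k N R^o l)) (linear_funZ (@kos_bottom_linear k
        N R^o l)).
      rewrite kos_bottom_kos_inj (linear_fun0 (@kos_bottom_linear k N R^o l)) => /eqP.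
      by rewrite addrC addr_eq0 => /eqP.
    move=> m; rewrite (perm_mem (msuppN _)); exact: kos_bottom_kos_d_in_vars.
  by exists v0; rewrite v0E.
have [||w uw] := IH p j (u + 'X_i *: v') ul p0.
- by rewrite kos_prD // hu kos_prX // hv'.
- by rewrite (linear_funD ld) (linear_funZ ld) -vE.
exists (w, - v') => /=; rewrite -uw scalerN addrK (linear_funN ld) opprK -vE.
by [].
Qed.

Local Notation allvars := (enum 'I_N).

Lemma in_allvars x : x@_0%MM = 0 -> in_vars allvars x.
Proof.
move=> x0 m mx; have [m0|/eqP] := eqVneq m 0%MM.
  by move: mx; rewrite m0 mcoeff_msupp x0 eqxx.
move=> m0; have [i mi] : exists i, m i != 0%N.
  apply: NNPP => h; apply: m0; apply/mnmP => i; rewrite mnm0E.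
  by apply/eqP/negPn/negP => mi; apply: h; exists i.
by exists i; rewrite ?mem_enum.
Qed.

Lemma koszul_zero_ring p j : (p != 0) || (j != 0) ->
  koszul_zero (L := R^o) pih allvars (fun y => y = 0) p j.
Proof.
move=> pj z hz /kos_in0 dz; suff [w ->] : exists w, z = kos_d w by exists w; apply/kos_in0;
  rewrite subrr.
have [p0|p0] := eqVneq p 0; last by apply: kos_exact hz dz; rewrite ?enum_uniq.
move: hz pj; rewrite p0 eqxx /= => /kos_pr0_kos_inj[x -> xj] j0.
have [|w dw] := @kos_inj_boundary allvars x; last by exists w.
apply: in_allvars; rewrite -xj; case: j j0 {xj} => d /= d0; last by rewrite mcoeff0.
apply: dhomog_nemf_coeff (pihomogP _ _ _) _.
apply/eqP => e; have {e} : mdeg (0%MM : 'X_{1..N}) = d := e.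
by rewrite mdeg0; move: d0; lia.
Qed.

(** * Free modules with shifted generators *)

Section Rows.
Variables (r : nat) (sh : 'I_r -> nat).
Local Notation L := 'rV[R]_r.

Definition rpr j (v : L) : L := \row_a pih (j - (sh a)%:Z) (v 0 a).

Lemma rpr_grading : is_grading rpr.
Proof.
split=> [j v w | j i v | j v]; apply/rowP => a; rewrite !mxE ?pihD ?pihK //.
by rewrite mulrC (pihMl _ _ (dhomogXi i)) mulrC addrAC.
Qed.

Definition row_entry a (v : L) : R^o := v 0 a.
Definition row_incl a (x : R^o) : L := x *: delta_mx 0 a.

Lemma row_entry_linear a : linear_fun (row_entry a).
Proof. by move=> e v w; rewrite /row_entry !mxE. Qed.

Lemma row_incl_linear a : linear_fun (row_incl a).
Proof. by move=> e x y; rewrite /row_incl scalerDl scalerA. Qed.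

Lemma kos_row_sum l (z : kos L l) :
  z = \sum_(a < r) kos_map (row_incl a) (kos_map (row_entry a) z).
Proof.
elim: l z => [|i l IH] z /=; first exact: row_sum_delta.
rewrite [z in LHS]surjective_pairing {1}(IH z.1) {1}(IH z.2).
rewrite (big_morph (fun q : (kos L l * kos L l)%type => q) (id1 := 0) (op1 := +%R)) //.
apply/esym/pairE; first by apply: (big_morph (fun q : (kos L l * kos L l)%type => q.1)).
by apply: (big_morph (fun q : (kos L l * kos L l)%type => q.2)).
Qed.

Lemma kos_map_row_entry_kos_pr a l p j (z : kos L l) :
  kos_map (row_entry a) (kos_pr rpr p j z) = kos_pr (L :=
    R^o) pih p (j - (sh a)%:Z) (kos_map (row_entry a) z).
Proof.
apply: kos_map_kos_pr; first exact: row_entry_linear.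
by move=> j' v; rewrite /row_entry mxE.
Qed.

Lemma koszul_zero_free p j : p != 0 -> koszul_zero rpr allvars (fun v => v = 0) p j.
Proof.
move=> p0 z hz /kos_in0 dz.
have ex a : exists w : kos R^o allvars, kos_map (row_entry a) z = kos_d w.
  apply: (kos_exact (p := p) (j := j - (sh a)%:Z)); rewrite ?enum_uniq //.
    by rewrite -kos_map_row_entry_kos_pr hz.
  rewrite kos_d_kos_map; last exact: row_entry_linear.
  by rewrite dz (linear_fun0 (@kos_map_linear k N _ _ _ allvars (row_entry_linear a))).
pose w a := proj1_sig (constructive_indefinite_description _ (ex a)).
have wE a : kos_map (row_entry a) z = kos_d (w a).
  exact: (proj2_sig (constructive_indefinite_description _ (ex a))).
exists (\sum_a kos_map (row_incl a) (w a)); apply/kos_in0.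
rewrite {1}(kos_row_sum z) (linear_fun_sum (@kos_d_linear k N L allvars)) -sumrB big1 // => a _.
by rewrite wE kos_d_kos_map ?subrr //; apply: row_incl_linear.
Qed.

Lemma row_boundary (y : L) : (forall a, (y 0 a)@_0%MM = 0) ->
  exists w : kos L allvars, kos_d w = kos_inj allvars y.
Proof.
move=> y0; have ex a : exists w : kos R^o allvars, kos_d w = kos_inj allvars (y 0 a : R^o).
  by apply: kos_inj_boundary; apply: in_allvars.
pose w a := proj1_sig (constructive_indefinite_description _ (ex a)).
have wE a : kos_d (w a) = kos_inj allvars (y 0 a : R^o).
  exact: (proj2_sig (constructive_indefinite_description _ (ex a))).
exists (\sum_a kos_map (row_incl a) (w a)).
rewrite (linear_fun_sum (@kos_d_linear k N L allvars)).
under eq_bigr => a _.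
  rewrite kos_d_kos_map; last exact: row_incl_linear.
  rewrite wE kos_map_kos_inj; last exact: row_incl_linear.
  over.
rewrite -(linear_fun_sum (@kos_inj_linear k N L allvars)) /=; congr kos_inj.
exact/esym/row_sum_delta.
Qed.
End Rows.
End Acyclicity.

(** * Koszul homology modulo monomials in the forms *)

Section KoszulForms.
Variables (k : fieldType) (N s delta c : nat) (F : 'I_s -> {mpoly k[N]}).
Local Notation R := {mpoly k[N]}.
Hypotheses (hF : forall i, F i \is delta.-homog).
Hypothesis nzd : forall (B : {set 'I_s}) j, (#|B| <= c)%N -> j \notin B ->
  nonzerodivisor (form_ideal F B) (F j).
Implicit Types (V : R -> Prop) (p j : int) (B : {set 'I_s}).

Definition ideal_koszul_zero V p j : Prop := koszul_zero (L := R^o) (@pih k N) (enum 'I_N) V p j.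

Lemma koszul_zero_ext (L : lmodType R) (pr : int -> L -> L) (l : seq 'I_N) (V V' : L -> Prop) p j :
  (forall x, V x <-> V' x) -> koszul_zero pr l V p j -> koszul_zero pr l V' p j.
Proof.
move=> h van z hz dz; have [|w hw] := van z hz.
  by apply: kos_in_mono dz => x /h.
by exists w; apply: kos_in_mono hw => x /h.
Qed.

Lemma graded_pih V j x : is_ideal V -> graded_ideal V -> V x -> V (pih j x).
Proof. by move=> idV gV Vx; case: j => d /=; [apply: gV | apply: ideal_zero]. Qed.

Lemma ideal_koszul_zero_step V V1 V' (e : nat) (f : R) p j : is_ideal V -> graded_ideal V ->
  f \is e.-homog -> (forall g, V1 g <-> V (g * f)) ->
  (forall g, V' g <-> exists v r, V v /\ g = v + r * f) ->
  ideal_koszul_zero V p j -> ideal_koszul_zero V1 (p - 1) (j - e%:Z) -> ideal_koszul_zero V' p j.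
Proof.
move=> idV gV hf h1 h'; have gr := @pih_grading k N.
apply: (@koszul_zero_cokernel _ _ R^o R^o _ _ (fun x => x * f) e V1 V V' _ gr gr) => //.
- by move=> a x y; rewrite /= mulrDl -scalerAl.
- by move=> i x; rewrite (pihMl _ _ hf) addrK.
- by move=> i x; apply: graded_pih.
Qed.

(** Modulo a regular sequence of forms of degree [delta], Koszul homology is
    concentrated on the line [j = delta * p]: each form adds a class of degree
    (1, [delta]). *)
Lemma ideal_koszul_zero_forms B p j : (#|B| <= c.+1)%N -> j != delta%:Z * p ->
  ideal_koszul_zero (form_ideal F B) p j.
Proof.
move: {2}#|B| (erefl #|B|) => n; elim: n B p j => [|n IH] B p j cB leB pj.
  apply: (@koszul_zero_ext _ _ _ (fun y : R^o => y = 0)).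
    move=> x; rewrite (cards0_eq cB); split=> [-> | /form_idealP[t ->]].
      exact: (ideal_zero (form_ideal_ideal F _)).
    by rewrite big_set0.
  apply: koszul_zero_ring; rewrite -negb_and; apply: contra pj => /andP[/eqP -> /eqP ->].
  by rewrite mulr0.
have /card_gt0P[b bB] : (0 < #|B|)%N by rewrite cB.
have cB' : #|B :\ b| = n by move: (cardsD1 b B); rewrite bB cB add1n => -[].
have bB' : b \notin B :\ b by rewrite !inE eqxx.
have nb := nzd (B := B :\ b) _ bB'; rewrite cB' in nb.
apply: (@ideal_koszul_zero_step (form_ideal F (B :\ b)) (form_ideal F (B :\ b)) _ delta (F b)).
- exact: form_ideal_ideal.
- exact: form_ideal_graded hF _.
- exact: hF.
- move=> g; split; first by move=> h; apply: (ideal_mulr (form_ideal_ideal F _)).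
  by apply: nb; rewrite -ltnS -cB.
- by move=> g; rewrite -{1}(setD1K bB); apply: form_idealU1.
- by apply: IH => //; rewrite cB' ltnW // -cB.
apply: IH => //; first by rewrite cB' ltnW // -cB.
by apply: contra pj => /eqP e; apply/eqP; move: e; lia.
Qed.

(** At the step of [u], the new quotient is the old one modulo a copy of R
    modulo the forms of [B], shifted by the degree of F^u. Its homology enters
    one homological degree higher, hence the [p - 1]. The tail [ws2] only serves
    to bring the filtration to the unit ideal. *)
Lemma ideal_koszul_zero_filtration pre ws1 ws2 p j :
  filtration pre (ws1 ++ ws2) -> (forall w, w \in ws1 ++ ws2 -> (#|w.2| <= c)%N) ->
  upset (catrev (unzip1 (ws1 ++ ws2)) pre) 0%MM ->
  (forall w, w \in ws1 -> j != (delta * mdeg w.1)%:Z + delta%:Z * (p - 1)) ->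
  ideal_koszul_zero (mono_ideal F (upset pre)) p j ->
    ideal_koszul_zero (mono_ideal F (upset (catrev (unzip1 ws1) pre))) p j.
Proof.
elim: ws1 pre => [|[u B] ws1 IH] pre //= [incl only fil] wc up0 hj van.
have wc' w : w \in ws1 ++ ws2 -> (#|w.2| <= c)%N.
  by move=> hw; apply: wc; rewrite inE hw orbT.
have cB : (#|B| <= c)%N by apply: (wc (u, B)); rewrite mem_head.
apply: IH => //; first by move=> w hw; apply: hj; rewrite inE hw orbT.
have T : tor1_zero F (upset (u :: pre)).
  by apply: (filtration_tor1 nzd) fil up0 => w /wc' h; rewrite leqW.
have only' b := upset_colon (b := b) only.
apply: (@ideal_koszul_zero_step (mono_ideal F (upset pre)) (form_ideal F B) _ (delta * mdeg u)
  (mmap1 F u)) van _.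
- exact: mono_ideal_ideal.
- exact: mono_ideal_graded hF _.
- exact: mmap1_homog hF _.
- move=> g; split; first exact: (mono_ideal_colon_incl incl).
  exact: (mono_ideal_colon (@upset_add _ pre) (upset_cons u pre) only' T).
- exact: (mono_ideal_step F (upset_cons u pre)).
apply: ideal_koszul_zero_forms; first exact: leqW.
have := hj (u, B) (mem_head _ _); apply: contra => /eqP e; apply/eqP.
by rewrite -e /= addrC subrK.
Qed.
End KoszulForms.

(** * Koszul homology along a minimal resolution *)

Section Resolution.
Variables (k : fieldType) (N : nat).
Local Notation R := {mpoly k[N]}.
Variables (I : R -> Prop) (C : free_complex k N).
Hypotheses (idI : is_ideal I) (gI : graded_ideal I).
Hypothesis minC : minimal_graded_free_resolution I C.
Local Notation allvars := (enum 'I_N).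
Implicit Types (p j : int).

Local Notation free i := 'rV[R]_(frank C i).
Definition resolution_pr i : int -> free i -> free i := rpr (@fshift k N C i).
Definition syzygies i (v : free i) : Prop := exists w, v = w *m fdiff C i.

Lemma syzygies_submod i : submod (@syzygies i).
Proof.
split.
- by exists 0; rewrite mul0mx.
- by move=> _ _ [w ->] [w' ->]; exists (w + w'); rewrite mulmxDl.
- by move=> a _ [w ->]; exists (a *: w); rewrite scalemxAl.
Qed.

Lemma zero_submod (L : lmodType R) : submod (fun v : L => v = 0).
Proof.
split=> // [x y -> ->|a x ->]; first by rewrite addr0.
by rewrite scaler0.
Qed.

Lemma fdiff_linear i : linear_fun (fun v : free i.+1 => v *m fdiff C i : free i).
Proof. by move=> a v w; rewrite mulmxDl scalemxAl. Qed.

Lemma fdiff_pr i j (v : free i.+1) :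
  resolution_pr j v *m fdiff C i = resolution_pr (j + 0) (v *m fdiff C i).
Proof.
have [[_ hd] _ _] := minC; apply/rowP => b; rewrite addr0 !mxE pih_sum.
apply: eq_bigr => a _; rewrite !mxE; have := hd i a b; case: leqP => ab hab.
  rewrite (pihMl _ _ hab) -addrA; congr (pih _ _ * _).
  by move: ab; move: (fshift a) (fshift b); lia.
by rewrite (eqP hab) !mulr0 pih0.
Qed.

(** The cokernel of the first differential is the quotient of R by [I]. *)
Lemma koszul_zero_syzygies0 p j : ideal_koszul_zero I p j ->
  koszul_zero (@resolution_pr 0) allvars (@syzygies 0) p j.
Proof.
have [[ha _] [[v0 hv0] res0 _] _] := minC => van.
pose phi (v : free 0) : R^o := (v *m faug C) 0 0.
have lphi : linear_fun phi by move=> a v w; rewrite /phi mulmxDl -scalemxAl !mxE.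
rewrite -[j]subr0; apply: (@koszul_zero_kernel _ _ _ R^o _ (@pih k N) phi 0 _ I (fun=> True)) => //.
- exact: pih_grading.
- move=> i v; rewrite /phi addr0 !mxE pih_sum; apply: eq_bigr => a _.
  by rewrite !mxE (pihMl _ _ (ha a)).
- by move=> i x; apply: graded_pih.
- by move=> v; rewrite res0.
- move=> y; split=> // _; exists (y * (1 - phi v0)), (y *: v0); split.
    exact: ideal_mull.
  by rewrite (linear_funZ lphi) mulrBr mulr1 subrK.
by move=> z _ _; exists 0; elim: allvars (z - _) => //= i l IH w; split; apply: IH.
Qed.

(** Dimension shifting: the Koszul homology of the free modules vanishes in
    positive degrees, so that passing to the next syzygies lowers the
    homological degree by one. *)
Lemma koszul_zero_syzygies q p j : 0 < p -> ideal_koszul_zero I (p + q%:Z) j ->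
  koszul_zero (@resolution_pr q) allvars (@syzygies q) p j.
Proof.
have [_ [_ _ ex] _] := minC.
elim: q p => [|q IH] p p0 van; first by apply: koszul_zero_syzygies0; rewrite addr0 in van.
have van' : koszul_zero (@resolution_pr q) allvars (@syzygies q) (p + 1) j.
  by apply: IH; [lia | rewrite -addrA -intS].
rewrite -[j]subr0; apply: (@koszul_zero_kernel _ _ _ _ (@resolution_pr q.+1) (@resolution_pr q)
  (fun v : free q.+1 => v *m fdiff C q : free q) 0 _ (fun v => v = 0) (@syzygies q)) van' _.
- exact: rpr_grading.
- exact: fdiff_linear.
- by move=> i v; apply: fdiff_pr.
- exact: zero_submod.
- move=> i v ->; apply/rowP => a; rewrite !mxE; exact: pih0.
- by move=> v; rewrite ex.
- move=> y; split=> [[w ->] | [v [w [-> ->]]]]; last by exists w; rewrite add0r.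
  by exists 0, w; rewrite add0r.
by apply: koszul_zero_free; lia.
Qed.

(** After dimension shifting, it suffices to find a nonzero class in degree 1
    modulo the syzygies. By minimality the image [y] of the basis element is the
    boundary of some [w] of degree 1. If [w] were a boundary modulo syzygies,
    then [y] would be a combination of syzygies with coefficients in the maximal
    ideal, and the basis element would lie in the maximal ideal times the free
    module, modulo the next differential. Minimality excludes this. *)
Lemma minimal_resolution_koszul_nonzero i (a : 'I_(frank C i.+1)) :
  ~ ideal_koszul_zero I i.+1%:Z (fshift a)%:Z.
Proof.
move=> van; have [[_ hd] [_ _ ex] mC] := minC.
have {van} van : koszul_zero (@resolution_pr i) allvars (@syzygies i) 1 (fshift a)%:Z.
  by apply: koszul_zero_syzygies => //; rewrite -intS.
set j := (fshift a)%:Z in van; pose y : free i := row a (fdiff C i).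
have gr := @rpr_grading k N _ (@fshift k N C i).
have hy : resolution_pr j y = y.
  have := @fdiff_pr i j (delta_mx 0 a); rewrite addr0 -rowE => <-.
  rewrite /y [in RHS]rowE; congr (_ *m _); apply/rowP => b; rewrite !mxE eqxx /=.
  have [-> | ba] := eqVneq b a; last exact: pih0.
  rewrite /j subrr /=; exact: pihomog_dE (dhomog1 _ _).
have [|w0 dw0] := row_boundary (y := y); first by move=> b; rewrite mxE; apply: mC.
pose w := kos_pr (@resolution_pr i) 1 j w0.
have dw : kos_d w = kos_inj allvars y by rewrite kos_d_kos_pr // dw0 subrr kos_pr_kos_inj // hy.
have Vy : syzygies y by exists (delta_mx 0 a); rewrite -rowE.
have [||w' hw'] := van w; first exact: kos_prK.
  rewrite dw; elim: allvars => //= i' l IH; split=> //.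
  by apply: submod0; apply: kos_in_submod; apply: syzygies_submod.
pose V' (v : free i) := exists2 g : free i.+1, v = g *m fdiff C i & forall b, (g 0 b)@_0%MM = 0.
have sV' : submod V'.
  split.
  - by exists 0; [rewrite mul0mx | move=> b; rewrite mxE mcoeff0].
  - move=> _ _ [g -> hg] [g' -> hg']; exists (g + g'); first by rewrite mulmxDl.
    by move=> b; rewrite mxE mcoeffD hg hg' addr0.
  - move=> e _ [g -> hg]; exists (e *: g); first by rewrite scalemxAl.
    by move=> b; rewrite mxE rmorphM /= hg mulr0.
have [g yg g0] : V' y.
  rewrite -(kos_bottom_kos_inj allvars y) -dw -[kos_d w]subr0 -(kos_dK w').
  rewrite -(linear_funB (@kos_d_linear k N (free i) allvars)).
  apply: (kos_bottom_kos_d_in (V := @syzygies i)) => // i' _ [g ->].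
  exists ('X_i' *: g); first by rewrite scalemxAl.
  by move=> b; rewrite mxE rmorphM /= mcoeffX mnm1_eq0 mul0r.
have : (delta_mx 0 a - g) *m fdiff C i = 0 by rewrite mulmxBl -rowE -yg subrr.
move=> /ex[h hE].
have := congr1 (fun v : free i.+1 => (v 0 a)@_0%MM) hE; rewrite !mxE !eqxx mcoeffB mcoeff1 eqxx g0.
rewrite raddf_sum big1 ?subr0 => [/eqP|b _]; first by rewrite oner_eq0.
by rewrite [LHS]/= rmorphM /= [X in _ * X]mC mulr0.
Qed.
End Resolution.

(** * Betti tables of the symbolic powers *)

Section Stranded.
Variables (k : fieldType) (n c s delta m : nat) (F : 'I_s -> {mpoly k[n.+1]}).
Hypotheses (hc : (1 <= c)%N) (hcs : (c < s)%N) (hm : (1 <= m)%N)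
  (delta_gt0 : (0 < delta)%N) (hF : forall i, F i \is delta.-homog).
Hypothesis nzd : forall (B : {set 'I_s}) j, (#|B| <= c)%N -> j \notin B ->
  nonzerodivisor (form_ideal F B) (F j).
Local Notation I := (symbolic_power (star_ideal c F) m).
Local Notation gens := (inner s c m).

Lemma symbolic_power_mono_ideal f : I f <-> mono_ideal F (in_symb c m) f.
Proof.
split; last exact: mono_ideal_symbolic_power.
move=> If; have : mono_ideal F (upset (rev (unzip1 gens))) f.
  apply: (symbolic_power_descent nzd (outer_filtration hc hcs hm)) If => [w||a].
  - by case/(outerP hc hcs hm)/outer_baseP.
  - exact: upset_outer.
  - by rewrite upset_inner.
by apply: mono_ideal_mono => a; rewrite upset_inner.
Qed.

Lemma symbolic_power_ideal : is_ideal I.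
Proof.
have idM := mono_ideal_ideal F (in_symb (s := s) c m).
split; first by apply/symbolic_power_mono_ideal; apply: ideal_zero.
- by move=> x y /symbolic_power_mono_ideal hx /symbolic_power_mono_ideal hy;
  apply/symbolic_power_mono_ideal; apply: ideal_add.
- by move=> a x /symbolic_power_mono_ideal hx; apply/symbolic_power_mono_ideal; apply: ideal_mull.
Qed.

Lemma symbolic_power_graded : graded_ideal I.
Proof.
by move=> d f /symbolic_power_mono_ideal hf; apply/symbolic_power_mono_ideal;
  apply: (mono_ideal_graded hF).
Qed.

Lemma inner_tor1 : tor1_zero F (upset (rev (unzip1 gens))).
Proof.
apply: (filtration_tor1 nzd) (outer_filtration hc hcs hm) _; last exact: upset_outer.
by move=> w /(outerP hc hcs hm)/outer_baseP[-> _ _].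
Qed.

(** The products F^u for the generators [u] form a minimal set of generators:
    none lies in the ideal of the others, by [mono_ideal_min_gen] applied
    with the ideal of polynomials without constant term. *)
Lemma min_gen_degree_inner w : w \in gens -> min_gen_degree I (delta * mdeg w.1).
Proof.
move=> wg; pose u (i : 'I_(size gens)) := (nth (0%MM, set0) gens i).1.
have uP i : exists M, generator c m M (u i).
  have /(innerP hc hcs hm)[M gM _] : nth (0%MM, set0) gens i \in gens by apply: mem_nth.
  by exists M.
have u_inj i j : u i = u j -> i = j.
  rewrite /u -!(nth_map _ 0%MM fst) // => /eqP.
  rewrite nth_uniq ?size_map //; last exact: (inner_uniq s c m).
  by move=> /eqP/val_inj.
exists (size gens), (fun i => mmap1 F (u i)); split; last first.
  have wi : (index w gens < size gens)%N by rewrite index_mem.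
  exists (Ordinal wi); rewrite /u /= nth_index //.
  exact: mmap1_homog.
split=> [i | f | i].
- by exists (delta * mdeg (u i))%N; apply: mmap1_homog.
- rewrite symbolic_power_mono_ideal; split.
    apply: ideal_gen_min => [|_ [a [/(generator_exists hc hcs hm)[v [M [gv va]]] ->]]];
      first exact: ideal_gen_ideal.
    rewrite (mmap1B F va); apply: (ideal_mull (ideal_gen_ideal _)); apply: ideal_gen_incl.
    have wi : (v, inner_colon v) \in gens by apply/(innerP hc hcs hm); exists M.
    have wi' : (index (v, inner_colon v) gens < size gens)%N by rewrite index_mem.
    by exists (Ordinal wi'); rewrite /u /= nth_index.
  apply: ideal_gen_min => [|_ [i ->]]; first exact: mono_ideal_ideal.
  by apply: mono_ideal_incl; have [M gM] := uP i; apply: generator_in_symb gM.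
pose V (f : {mpoly k[n.+1]}) := f@_0%MM = 0.
have idV : is_ideal V.
  rewrite /V; split; first exact: mcoeff0.
  - by move=> x y hx hy; rewrite mcoeffD hx hy addr0.
  - by move=> a x hx; rewrite rmorphM /= hx mulr0.
have VF j : V (F j).
  apply: dhomog_nemf_coeff (hF j) _; apply/eqP => e.
  by have : mdeg (0%MM : 'X_{1..n.+1}) = delta := e; rewrite mdeg0; lia.
have [M gM] := uP i.
move=> hi; have : V 1.
  apply: (mono_ideal_min_gen inner_tor1 idV VF (u := u i)).
  - by rewrite upset_inner //; apply: generator_in_symb gM.
  - by move=> a; rewrite upset_inner // => ha le; apply: (generator_minimal hc hcs hm gM).
  apply: ideal_gen_mono hi => _ [j ji ->]; exists (u j); split=> //.
  rewrite upset_inner //; have [M' gM'] := uP j; rewrite (generator_in_symb hc hcs hm gM') /=.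
  by apply: contra ji => /eqP/u_inj ->.
by rewrite /V mcoeff1 eqxx => /eqP; rewrite oner_eq0.
Qed.

Lemma symbolic_power_koszul_zero (i j : nat) : (1 <= i)%N ->
  (forall w, w \in gens -> j != (delta * mdeg w.1 + delta * (i - 1))%N) ->
  ideal_koszul_zero I i%:Z j%:Z.
Proof.
move=> i1 hj; have colons w : w \in gens ++ outer s c m -> (#|w.2| <= c)%N.
  rewrite mem_cat => /orP[/(innerP hc hcs hm)[M gM ->] | /(outerP hc hcs hm)/outer_baseP[-> _
    _]] //.
  exact: ltnW (card_colon_in hc hcs hm gM).
apply: (koszul_zero_ext (L := {mpoly k[n.+1]}^o) (V := mono_ideal F (upset (rev (unzip1 gens))))).
  move=> f; rewrite symbolic_power_mono_ideal.
  by split; apply: mono_ideal_mono => a; rewrite upset_inner.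
rewrite /rev; apply: (ideal_koszul_zero_filtration hF nzd) colons _ _ _.
- apply: filtration_cat; first exact: inner_filtration.
  by rewrite -/(rev _); apply: outer_filtration.
- by rewrite /unzip1 map_cat catrevE rev_cat cats0 -catrevE; exact: upset_outer.
- move=> w /hj; apply: contra => /eqP e; apply/eqP; move: e.
  have -> : i%:Z - 1 = (i - 1)%N%:Z by lia.
  by rewrite -PoszM -PoszD => -[].
apply: (koszul_zero_ext (L := {mpoly k[n.+1]}^o) (V := fun y => y = 0)); last first.
  by apply: koszul_zero_ring; apply/orP; left; lia.
move=> x; split=> [-> | ]; first exact: (ideal_zero (mono_ideal_ideal F _)).
by case/mono_idealP=> r [e [a [ha ->]]]; rewrite big1 // => q _; have := ha q.
Qed.

Lemma symbolic_power_stranded : stranded_betti_table delta I.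
Proof.
move=> i j i1; rewrite /betti.
case: excluded_middle_informative => // ex.
case: (constructive_indefinite_description _ ex) => C minC /= card0.
have /card_gt0P[a] : (0 < #|[set a : 'I_(frank C i) | fshift a == j]|)%N.
  by rewrite lt0n; apply/eqP.
rewrite inE => /eqP aj.
have [[w wg jE]|hno] := classic (exists2 w, w \in gens &
    j = (delta * mdeg w.1 + delta * (i - 1))%N).
  by exists (delta * mdeg w.1)%N => //; apply: min_gen_degree_inner.
have van : ideal_koszul_zero I i%:Z j%:Z.
  by apply: symbolic_power_koszul_zero => // w wg; apply/eqP => e; apply: hno; exists w.
case: i i1 a aj card0 hno van => // i _ a aj _ _ van; exfalso.
have := minimal_resolution_koszul_nonzero symbolic_power_ideal symbolic_power_graded minC (a := a).
by rewrite aj => /(_ van).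
Qed.
End Stranded.

(** Constants cannot start a regular sequence: a zero is a zero divisor and a
    nonzero constant generates the unit ideal. *)
Lemma regular_sequence_degree_gt0 (k : fieldType) (n c s delta : nat) (F : 'I_s -> {mpoly k[n]}) :
  (c < s)%N -> (forall i, F i \is delta.-homog) ->
  (forall A : {set 'I_s}, #|A| = c.+1 -> regular_sequence [seq F i | i <- enum A]) ->
  (0 < delta)%N.
Proof.
move=> cs hF reg; rewrite lt0n; apply/eqP => d0.
have [A _ cA] : exists2 A : {set 'I_s}, set0 \subset A & #|A| = c.+1.
  by apply: set_extension; rewrite cards0 card_ord.
have := reg A cA; case eA: (enum A) => [|a l] /=; first by move: cA; rewrite cardE eA.
case=> /(_ 0%N erefl 1) /=; rewrite mul1r => h0 h1.
have [e eE] : exists e : k, F a = e%:MP.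
  have := hF a; rewrite d0 => /dhomogP ha; exists (F a)@_0%MM; apply/mpolyP => q.
  rewrite mcoeffC; case: (eqVneq q 0%MM) => [->|q0]; first by rewrite ?eqxx mulr1.
  rewrite mulr0; apply/eqP; rewrite mcoeff_eq0; apply/negP => /ha.
  by move=> e; move: q0; rewrite -mdeg_eq0 => /eqP; apply; exact: e.
have [e0|e0] := eqVneq e 0.
  have /h0 : ideal_gen (fun h => h \in [::]) (F a).
    by rewrite eE e0 mpolyC0; apply: ideal_zero (ideal_gen_ideal _).
  have : forall f, ideal_gen (fun h : {mpoly k[n]} => h \in [::]) f -> f = 0.
    apply: (ideal_gen_min (I := fun f => f = 0)) => [|g //].
    by split=> // [x y -> ->|b x ->]; rewrite ?addr0 ?mulr0.
  by move=> /[apply] /eqP; rewrite oner_eq0.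
apply: h1; rewrite (_ : 1 = e^-1%:MP * F a); last by rewrite eE -mpolyCM mulVf // mpolyC1.
by apply: (ideal_mull (ideal_gen_ideal _)); apply: ideal_gen_incl; rewrite mem_head.
Qed.

Theorem corollary7p1 (k : fieldType) (n c s delta : nat)
    (F : 'I_s -> {mpoly k[n.+1]})
    (hc : (1 <= c)%N) (hcs : (c < s)%N)
    (hF : forall i, F i \is delta.-homog)
    (hreg : forall A : {set 'I_s}, #|A| = c.+1 ->
       regular_sequence [seq F i | i <- enum A]) :
  (forall m : nat, (1 <= m)%N ->
     koszul_stranded (symbolic_power (star_ideal c F) m)) /\
  (delta = 1%N -> forall m : nat, (1 <= m)%N ->
     linearly_stranded (symbolic_power (star_ideal c F) m)).
Proof.
have d0 := regular_sequence_degree_gt0 hcs hF hreg.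
have nzd := nonzerodivisor_forms d0 hF hcs hreg.
have strand m (hm : (1 <= m)%N) := symbolic_power_stranded hc hcs hm d0 hF nzd.
split=> [m hm | d1 m hm]; first by exists delta => //; apply: strand.
by rewrite /linearly_stranded -{1}d1; apply: strand.
Qed.
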